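(* Let $\mathcal{A}$ be a (not necessarily unital) $C^*$-algebra over $\mathbb{C}$ with $\mathcal{A} \neq \{0\}$. The following properties of $\mathcal{A}$ are equivalent: (1) $\mathcal{A}$ has the fixed point property for nonexpansive maps (FPP); (2) $\mathrm{spec}(A)$ is finite for every self-adjoint element $A \in \mathcal{A}$; (3) $\mathcal{A}$ is finite dimensional (as a complex vector space).
   Context: If $\mathcal{B}$ is a Banach space and $K \subset \mathcal{B}$, a map $M : K \to K$ is nonexpansive if $\|M(x)-M(y)\| \le \|x-y\|$ for all $x,y \in K$. $\mathcal{B}$ has the fixed point property for nonexpansive maps (FPP) if, whenever $K$ is a nonempty bounded closed convex subset of $\mathcal{B}$ and $M: K \to K$ is nonexpansive, $M$ has a fixed point in $K$. For a $C^*$-algebra $\mathcal{A}$, let $\widetilde{\mathcal{A}}$ denote $\mathcal{A}$ if $\mathcal{A}$ is unital and the unitization of $\mathcal{A}$ otherwise, with unit $I$. The spectrum of $A \in \mathcal{A}$ is $\mathrm{spec}(A) = \{\mu \in \mathbb{C} : \mu I - A \text{ is not invertible in } \widetilde{\mathcal{A}}\}$. *)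

(* Defs.v *)
(* MathComp-Analysis; the complex numbers are R[i] for an arbitrary R : realType. *)
From HB Require Import structures.
From mathcomp Require Import all_boot all_order all_algebra.
From mathcomp Require Import all_classical all_reals all_analysis.
From mathcomp Require Import complex.

Set Implicit Arguments.
Unset Strict Implicit.
Unset Printing Implicit Defensive.

Import Order.TTheory GRing.Theory Num.Theory.
Import numFieldNormedType.Exports.

Local Open Scope classical_set_scope.
Local Open Scope ring_scope.

(* The norm of a normed module over R[i] takes its values in R[i]; they are
   nonnegative for the partial order of R[i], hence real. *)
HB.mixin Record CompleteNormedModule_isCStarAlgebra (R : realType) A
    of CompleteNormedModule R[i] A := {
  cmul : A -> A -> A ;
  cstar : A -> A ;
  cmulA : associative cmul ;
  cmulDl : left_distributive cmul +%R ;
  cmulDr : right_distributive cmul +%R ;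
  cmulZl : forall (k : R[i]) (x y : A), cmul (k *: x) y = k *: cmul x y ;
  cmulZr : forall (k : R[i]) (x y : A), cmul x (k *: y) = k *: cmul x y ;
  cmul_norm : forall x y : A, `|cmul x y| <= `|x| * `|y| ;
  cstarK : involutive cstar ;
  cstarD : {morph cstar : x y / x + y} ;
  cstarZ : forall (k : R[i]) (x : A), cstar (k *: x) = conjc k *: cstar x ;
  cstarM : forall x y : A, cstar (cmul x y) = cmul (cstar y) (cstar x) ;
  cstar_norm : forall x : A, `|cmul (cstar x) x| = `|x| ^+ 2
}.

(* No unit is assumed. *)
#[short(type="cstarAlgType")]
HB.structure Definition CStarAlgebra (R : realType) :=
  {A of CompleteNormedModule R[i] A
      & CompleteNormedModule_isCStarAlgebra R A}.

Section FixedPointProperty.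
Context {K : numFieldType} (B : completeNormedModType K).

Definition nonexpansive (C : set B) (M : B -> B) : Prop :=
  forall x y, C x -> C y -> `|M x - M y| <= `|x - y|.

(* The scalars in [convex_set] are the t : K with 0 <= t <= 1; for K = R[i]
   these are exactly the real numbers of the unit interval. A map C -> C is
   represented by a function B -> B that maps C to C. *)
Definition fixed_point_property : Prop :=
  forall C : set B, C !=set0 -> bounded_set C -> closed C -> convex_set C ->
  forall M : {fun C >-> C}, nonexpansive C M -> exists2 x, C x & M x = x.

End FixedPointProperty.

Section Spectrum.
Context {R : realType} {A : cstarAlgType R}.

Definition is_unity (e : A) : Prop := forall x, cmul e x = x /\ cmul x e = x.

(* The underlying algebra of the unitization, (a, k) standing for a + k I. The
   C*-norm on it plays no role in invertibility. *)
Definition unitization : lmodType R[i] := (A * R[i]^o)%type.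

Definition unitization_mul (u v : unitization) : unitization :=
  (cmul u.1 v.1 + v.2 *: u.1 + u.2 *: v.1, u.2 * v.2).

Definition unitization_one : unitization := (0, 1).

Definition unitization_inj (a : A) : unitization := (a, 0).

Definition invertible {T : Type} (mul : T -> T -> T) (e x : T) : Prop :=
  exists y, mul x y = e /\ mul y x = e.

Definition spec (a : A) : set R[i] := [set mu |
  (exists2 e, is_unity e & ~ invertible cmul e (mu *: e - a)) \/
  ((forall e, ~ is_unity e) /\
   ~ invertible unitization_mul unitization_one
       (mu *: unitization_one - unitization_inj a))].

End Spectrum.

Definition finite_dimensional (K : fieldType) (V : lmodType K) : Prop :=
  exists n : nat, inhabited (Vector.axiom n V).

(* Main.v *)
(** The bridge between the three properties is the absence of an infinite
    sequence of nonzero self-adjoint elements with pairwise product zero.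

    Such a sequence [e n], normalised, spans an isometric copy of [c_0], and on
    the closure of the finite sums of [l n * e n] with [0 <= l n <= 1] the
    shift [l |-> (1, l 0, l 1, ...)] is an isometry without fixed point.  It
    also yields a self-adjoint element with infinite spectrum: replacing [e n]
    by elements [m n] that have an eigenvector for the eigenvalue [1], the
    number [2^-n] is an eigenvalue of the sum of the [2^-n * m n].

    If there is no such sequence, every nonzero self-adjoint element dominates
    an irreducible one, from which a projection [p] with [p A p = C p] is
    obtained.  A maximal orthogonal family of such projections is finite and
    sums to a unit, and each [p A q] has dimension at most one.

    In place of the continuous functional calculus there is only one square
    root: for a self-adjoint contraction [w], the iteration [y := (w + y^2) / 2]
    converges to a solution of [(1 - y)^2 = 1 - w].

    In finite dimension, a nonexpansive map has minimal displacement at some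
    point of a compact convex set, and contractions close to it have fixed
    points, so the minimum is zero. *)
Require Import Defs.
From HB Require Import structures.
From mathcomp Require Import all_boot all_order all_algebra.
From mathcomp Require Import all_classical all_reals all_analysis.
From mathcomp Require Import complex ring lra.

Set Implicit Arguments.
Unset Strict Implicit.
Unset Printing Implicit Defensive.

Import Order.TTheory GRing.Theory Num.Theory.
Import numFieldNormedType.Exports.

Local Open Scope classical_set_scope.
Local Open Scope complex_scope.
Local Open Scope ring_scope.

Local Notation "x ** y" := (cmul x y) (at level 40, left associativity).

(** * Linear identities in modules *)

Section ModuleExpressions.
Context {K : pzRingType} {V : lmodType K}.

(** Syntax for proof by reflection: an identity between linear combinations reduces to one scalar
    identity per atom. *)
Inductive mexp :=
| MVar of nat | MZero | MAdd of mexp & mexp | MOpp of mexp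
| MScale of K & mexp | MMuln of mexp & nat.

Fixpoint meval (s : seq V) (e : mexp) : V :=
  match e with
  | MVar n => s`_n
  | MZero => 0
  | MAdd a b => meval s a + meval s b
  | MOpp a => - meval s a
  | MScale k a => k *: meval s a
  | MMuln a n => meval s a *+ n
  end.

(** [Nat.eqb] rather than [==] lets the [cbv] of [mod_eqs] compute the coefficients. *)
Fixpoint mcoef (i : nat) (e : mexp) : K :=
  match e with
  | MVar n => if Nat.eqb i n then 1 else 0
  | MZero => 0
  | MAdd a b => mcoef i a + mcoef i b
  | MOpp a => - mcoef i a
  | MScale k a => k * mcoef i a
  | MMuln a n => mcoef i a *+ n
  end.

Fixpoint meqs (e1 e2 : mexp) (n : nat) : Prop :=
  if n is n'.+1 then mcoef n' e1 = mcoef n' e2 /\ meqs e1 e2 n' else True.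

Lemma mevalE (s : seq V) (e : mexp) :
  meval s e = \sum_(i < size s) mcoef i e *: s`_i.
Proof.
elim: e => /= [n||a -> b ->|a ->|k a ->|a -> n].
- have H i : (if Nat.eqb i n then 1 else 0 : K) = (i == n)%:R.
    by rewrite -[Nat.eqb i n]/(i == n); case: (i == n).
  under eq_bigr do rewrite H.
  have [ns|ns] := ltnP n (size s).
    rewrite (bigD1 (Ordinal ns)) //= eqxx scale1r big1 ?addr0// => i.
    by rewrite -val_eqE /= => /negPf ->; rewrite scale0r.
  rewrite nth_default// big1// => i _.
  by rewrite (ltn_eqF (leq_trans (ltn_ord i) ns)) scale0r.
- by rewrite big1// => i _; rewrite scale0r.
- by rewrite -big_split; apply: eq_bigr => i _; rewrite scalerDl.
- by rewrite -sumrN; apply: eq_bigr => i _; rewrite scaleNr.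
- by rewrite scaler_sumr; apply: eq_bigr => i _; rewrite scalerA.
- by rewrite -sumrMnl; apply: eq_bigr => i _; rewrite scalerMnl.
Qed.

Lemma meval_eq (s : seq V) (e1 e2 : mexp) :
  meqs e1 e2 (size s) -> meval s e1 = meval s e2.
Proof.
rewrite !mevalE.
suff H n : meqs e1 e2 n ->
    \sum_(i < n) mcoef i e1 *: s`_i = \sum_(i < n) mcoef i e2 *: s`_i by exact: H.
elim: n => [_|n IH /= [h /IH]]; first by rewrite !big_ord0.
by rewrite !big_ord_recr /= => ->; rewrite h.
Qed.

End ModuleExpressions.

Ltac mfind x l :=
  lazymatch l with
  | ?y :: ?l' => match constr:(Set) with
                 | _ => let _ := match goal with _ => constr_eq x y end in constr:(0%N)
                 | _ => let n := mfind x l' in constr:(S n) end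
  end.
Ltac mhas x l :=
  lazymatch l with
  | nil => constr:(false)
  | ?y :: ?l' => match constr:(Set) with
                 | _ => let _ := match goal with _ => constr_eq x y end in constr:(true)
                 | _ => mhas x l' end
  end.
Ltac matoms t l :=
  lazymatch t with
  | (?a + ?b)%R => let l' := matoms a l in matoms b l'
  | (- ?a)%R => matoms a l
  | (_ *: ?a)%R => matoms a l
  | (?a *+ _)%R => matoms a l
  | 0%R => l
  | _ => let h := mhas t l in
         lazymatch h with true => l | false => constr:(t :: l) end
  end.
Ltac mquote t l :=
  lazymatch t with
  | (?a + ?b)%R => let a' := mquote a l in let b' := mquote b l in uconstr:(MAdd a' b')
  | (- ?a)%R => let a' := mquote a l in uconstr:(MOpp a')
  | (?k *: ?a)%R => let a' := mquote a l in uconstr:(MScale k a')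
  | (?a *+ ?n)%R => let a' := mquote a l in uconstr:(MMuln a' n)
  | 0%R => uconstr:(MZero)
  | _ => let n := mfind t l in uconstr:(MVar n)
  end.
(* Leaves one equation between scalars per atom of a linear identity. *)
Ltac mod_eqs :=
  lazymatch goal with
  | |- @eq ?T ?x ?y =>
    let l := matoms x constr:(@nil T) in
    let l := matoms y l in
    let e1 := mquote x l in
    let e2 := mquote y l in
    change (meval l e1 = meval l e2); apply: meval_eq;
    cbv [meqs mcoef size Nat.eqb]; repeat split
  end.
Ltac module := mod_eqs; ring.

(** * Real-valued norm and limits *)

Lemma divr2_gt0 (R : realFieldType) (e : R) : 0 < e -> 0 < e / 2.
Proof. by lra. Qed.

Section RealNorm.
Context {R : realType} {V : normedModType R[i]}.
Implicit Types (x y : V) (k : R[i]) (r : R).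

(** A value in the totally ordered field [R] is accessible to [lra], [nra] and suprema. *)
Definition nrm x : R := complex.Re `|x|.

Lemma nrmE x : `|x| = (nrm x)%:C.
Proof. by rewrite /nrm RRe_real// normr_real. Qed.

Lemma nrm_ge0 x : 0 <= nrm x.
Proof. by rewrite -ler0c -nrmE. Qed.

Lemma nrm_le x y : (`|x| <= `|y|) = (nrm x <= nrm y).
Proof. by rewrite !nrmE lecR. Qed.

Lemma nrm0 : nrm 0 = 0.
Proof. by rewrite /nrm normr0. Qed.

Lemma nrm_eq0 x : (nrm x == 0) = (x == 0).
Proof. by rewrite -[RHS]normr_eq0 nrmE -(inj_eq (@complexI _)). Qed.

Lemma nrm_gt0 x : (0 < nrm x) = (x != 0).
Proof. by rewrite lt0r nrm_eq0 nrm_ge0 andbT. Qed.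

Lemma nrm_le0 x : nrm x <= 0 -> x = 0.
Proof. by move=> h; apply/eqP; rewrite -nrm_eq0 eq_le h nrm_ge0. Qed.

Lemma nrmD x y : nrm (x + y) <= nrm x + nrm y.
Proof. by rewrite -lecR rmorphD /= -!nrmE ler_normD. Qed.

Lemma nrmN x : nrm (- x) = nrm x.
Proof. by rewrite /nrm normrN. Qed.

Lemma nrmB x y : nrm (x - y) <= nrm x + nrm y.
Proof. by rewrite -(nrmN y) nrmD. Qed.

Lemma nrm_sym x y : nrm (x - y) = nrm (y - x).
Proof. by rewrite -nrmN opprB. Qed.

Lemma nrm_dist x y z : nrm (x - z) <= nrm (x - y) + nrm (y - z).
Proof. by apply: le_trans (nrmD _ _); rewrite addrA subrK. Qed.

Lemma nrmZ k x : nrm (k *: x) = complex.Re `|k| * nrm x.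
Proof.
by rewrite /nrm normrZ !nrmE normc_def /= mul0r subr0.
Qed.

Lemma nrmZr r x : nrm (r%:C *: x) = `|r| * nrm x.
Proof. by rewrite nrmZ normc_def /= expr0n addr0 sqrtr_sqr. Qed.

Lemma nrm_lip x y : `|nrm x - nrm y| <= nrm (x - y).
Proof.
have := nrm_dist x y 0; have := nrm_dist y x 0; rewrite !subr0 (nrm_sym y) ler_norml.
by lra.
Qed.

Lemma nrm_eps x : (forall e : R, 0 < e -> nrm x <= e) -> x = 0.
Proof.
by move=> h; apply: nrm_le0; apply/ler_addgt0Pl => e e0; rewrite addr0 h.
Qed.

Definition approximable (C : set V) x :=
  forall e : R, 0 < e -> exists2 y, C y & nrm (y - x) < e.

Lemma closureP (C : set V) x : closure C x <-> approximable C x.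
Proof.
split=> [h e e0|h U].
  have /h [y [Cy]] : nbhs x (ball x e%:C).
    by apply: nbhsx_ballx; rewrite ltcR.
  rewrite -ball_normE /ball_/= distrC nrmE ltcR => xy.
  by exists y.
move/nbhs_ballP => [e /= e0 xU].
have eR : e = (complex.Re e)%:C by rewrite RRe_real// gtr0_real.
have /h [y Cy yx] : 0 < complex.Re e by rewrite -ltcR -eR.
exists y; split=> //; apply: xU.
by rewrite -ball_normE /ball_/= distrC nrmE eR ltcR.
Qed.

Lemma closed_approximable (C : set V) :
  closed C <-> (forall x, approximable C x -> C x).
Proof. by split=> h x; move/closureP/h. Qed.

Definition ncvg (u : nat -> V) x :=
  forall e : R, 0 < e -> exists N, forall n, (N <= n)%N -> nrm (u n - x) < e.

End RealNorm.

Lemma ncvg_complete (R : realType) (V : completeNormedModType R[i])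
    (u : nat -> V) :
  (forall e : R, 0 < e -> exists N, forall n, (N <= n)%N ->
     nrm (u n - u N) < e) ->
  exists l, ncvg u l.
Proof.
move=> h.
have /cauchy_cvgP cu : cauchy (u @ \oo).
  apply: cauchy_exP => e e0.
  have eR : e = (complex.Re e)%:C by rewrite RRe_real// gtr0_real.
  have /h [N hN] : 0 < complex.Re e by rewrite -ltcR -eR.
  exists (u N); exists N => // n /= Nn; rewrite -ball_normE /ball_/= distrC.
  by rewrite nrmE eR ltcR; exact: hN.
exists (lim (u @ \oo)) => e e0.
have /cvgrPdist_lt/(_ e%:C) := cu; rewrite ltcR => /(_ e0) [N _ hN].
by exists N => n Nn; have := hN n Nn; rewrite /= distrC nrmE ltcR.
Qed.

(** Once [a] is within [e] of its supremum, its further increments, and hence those of [u], add up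
    to less than [e]. *)
Lemma ncvg_dominated (R : realType) (V : completeNormedModType R[i])
    (u : nat -> V) (a : nat -> R) (M : R) :
  (forall n, a n <= M) -> (forall n, nrm (u n.+1 - u n) <= a n.+1 - a n) ->
  exists l, ncvg u l.
Proof.
move=> aM ua.
have uaD n k : nrm (u (n + k)%N - u n) <= a (n + k)%N - a n.
  elim: k => [|k IH]; first by rewrite addn0 !subrr nrm0.
  rewrite addnS; apply: le_trans (nrm_dist _ (u (n + k)%N) _) _.
  by apply: le_trans (lerD (ua _) IH) _; rewrite addrA subrK.
have sup_a : has_sup (range a).
  by split; [exists (a 0%N), 0%N | exists M => _ [n _ <-]].
apply: ncvg_complete => e e0.
have [_ [N _ <-] aN] := sup_adherent e0 sup_a.
exists N => n /subnKC <-; apply: le_lt_trans (uaD _ _) _.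
have : a (N + (n - N))%N <= sup (range a).
  by apply: sup_upper_bound => //; exists (N + (n - N))%N.
move: aN; lra.
Qed.

Section Limits.
Context {R : realType} {V : normedModType R[i]}.
Implicit Types (u v : nat -> V) (x y : V).

Lemma ncvg_cst x : ncvg (fun=> x) x.
Proof. by move=> e e0; exists 0%N => n _; rewrite subrr nrm0. Qed.

Lemma ncvg_unique u x y : ncvg u x -> ncvg u y -> x = y.
Proof.
move=> ux uy; apply/eqP; rewrite -subr_eq0; apply/eqP/nrm_eps => e e0.
have [N hN] := ux _ (divr2_gt0 e0).
have [N' hN'] := uy _ (divr2_gt0 e0).
have := hN (maxn N N') (leq_maxl _ _); have := hN' (maxn N N') (leq_maxr _ _).
have := nrm_dist x (u (maxn N N')) y; rewrite (nrm_sym x (u _)); lra.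
Qed.

Lemma ncvg_shift u x : ncvg u x -> ncvg (fun n => u n.+1) x.
Proof. by move=> ux e /ux [N h]; exists N => n Nn; apply/h/leqW. Qed.

Lemma ncvgD u v x y : ncvg u x -> ncvg v y -> ncvg (fun n => u n + v n) (x + y).
Proof.
move=> ux vy e e0.
have [N hN] := ux _ (divr2_gt0 e0).
have [N' hN'] := vy _ (divr2_gt0 e0).
exists (maxn N N') => n; rewrite geq_max => /andP[/hN h /hN' h'].
have -> : u n + v n - (x + y) = (u n - x) + (v n - y) by module.
by have := nrmD (u n - x) (v n - y); lra.
Qed.

Lemma ncvg_lip (W : normedModType R[i]) (f : V -> W) (c : R) u x :
  (forall y z, nrm (f y - f z) <= c * nrm (y - z)) ->
  ncvg u x -> ncvg (fun n => f (u n)) (f x).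
Proof.
move=> fc ux e e0.
have c0 : 0 < `|c| + 1 by rewrite ltr_wpDl.
have [N hN] := ux _ (divr_gt0 e0 c0).
exists N => n /hN; rewrite ltr_pdivlMr// => h.
apply: le_lt_trans (fc _ _) _; apply: le_lt_trans h; rewrite mulrC.
by apply: ler_wpM2l; [exact: nrm_ge0 | rewrite ler_wpDr// ler_norm].
Qed.

Lemma ncvgZ k u x : ncvg u x -> ncvg (fun n => k *: u n) (k *: x).
Proof.
by apply: (@ncvg_lip _ _ (complex.Re `|k|)) => y z; rewrite -scalerBr nrmZ.
Qed.

Lemma nrm_ncvg_le u x c : (forall n, nrm (u n) <= c) -> ncvg u x -> nrm x <= c.
Proof.
move=> uc ux; apply/ler_addgt0Pl => e /ux [N /(_ _ (leqnn _)) h].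
have := nrm_dist x (u N) 0; rewrite !subr0 (nrm_sym x (u _)).
by have := uc N; lra.
Qed.

End Limits.

(** * Square roots of contractions *)

Section CStarBasics.
Context {R : realType} {A : cstarAlgType R}.
Implicit Types (x y z u w : A) (k : R[i]) (r : R).

Lemma cmul0l x : 0 ** x = 0.
Proof. by apply: (addIr (0 ** x)); rewrite -cmulDl !add0r. Qed.

Lemma cmul0r x : x ** 0 = 0.
Proof. by apply: (addIr (x ** 0)); rewrite -cmulDr !add0r. Qed.

Lemma cmulNl x y : (- x) ** y = - (x ** y).
Proof. by rewrite -scaleN1r cmulZl scaleN1r. Qed.

Lemma cmulNr x y : x ** (- y) = - (x ** y).
Proof. by rewrite -scaleN1r cmulZr scaleN1r. Qed.

Lemma cmulBl x y z : (x - y) ** z = x ** z - y ** z.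
Proof. by rewrite cmulDl cmulNl. Qed.

Lemma cmulBr x y z : z ** (x - y) = z ** x - z ** y.
Proof. by rewrite cmulDr cmulNr. Qed.

Lemma cmul_suml (I : Type) (s : seq I) (P : pred I) (F : I -> A) x :
  (\sum_(i <- s | P i) F i) ** x = \sum_(i <- s | P i) (F i ** x).
Proof. exact: (big_morph (fun y => y ** x) (fun a b => cmulDl a b x) (cmul0l x)). Qed.

Lemma cmul_sumr (I : Type) (s : seq I) (P : pred I) (F : I -> A) x :
  x ** (\sum_(i <- s | P i) F i) = \sum_(i <- s | P i) (x ** F i).
Proof. exact: (big_morph (cmul x) (fun a b => cmulDr x a b) (cmul0r x)). Qed.

Lemma cstar0 : cstar 0 = 0 :> A.
Proof. by apply: (addIr (cstar 0)); rewrite -cstarD !add0r. Qed.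

Lemma cstarN x : cstar (- x) = - cstar x.
Proof. by rewrite -scaleN1r cstarZ rmorphN1 scaleN1r. Qed.

Lemma cstarB x y : cstar (x - y) = cstar x - cstar y.
Proof. by rewrite cstarD cstarN. Qed.

Lemma cstarZr r x : cstar (r%:C *: x) = r%:C *: cstar x.
Proof. by rewrite cstarZ conjc_real. Qed.

Lemma nrmM x y : nrm (x ** y) <= nrm x * nrm y.
Proof. by rewrite -lecR rmorphM /= -!nrmE cmul_norm. Qed.

Lemma nrm_cstar_mul x : nrm (cstar x ** x) = nrm x ^+ 2.
Proof. by apply: (@complexI R); rewrite rmorphXn /= -!nrmE cstar_norm. Qed.

Lemma nrm_cstar x : nrm (cstar x) = nrm x.
Proof.
suff le y : nrm y <= nrm (cstar y).
  by apply/eqP; rewrite eq_le le -{2}(cstarK x) le.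
have [->|y0] := eqVneq y 0; first by rewrite nrm0 nrm_ge0.
have := nrmM (cstar y) y; rewrite nrm_cstar_mul expr2.
by rewrite ler_pM2r// nrm_gt0.
Qed.

Lemma ncvgMl x (u : nat -> A) z : ncvg u z -> ncvg (fun n => x ** u n) (x ** z).
Proof. by apply: (@ncvg_lip _ _ _ (cmul x) (nrm x)) => a b; rewrite -cmulBr nrmM. Qed.

Lemma ncvgMr x (u : nat -> A) z : ncvg u z -> ncvg (fun n => u n ** x) (z ** x).
Proof.
by apply: (@ncvg_lip _ _ _ (cmul^~ x) (nrm x)) => a b; rewrite -cmulBl mulrC nrmM.
Qed.

Lemma ncvg_star (u : nat -> A) z : ncvg u z -> ncvg (fun n => cstar (u n)) (cstar z).
Proof.
by apply: (@ncvg_lip _ _ _ (@cstar _ A) 1) => a b; rewrite -cstarB nrm_cstar mul1r.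
Qed.

Definition sa x := cstar x = x.

Lemma nrm_sqr x : sa x -> nrm (x ** x) = nrm x ^+ 2.
Proof. by move=> sx; rewrite -nrm_cstar_mul sx. Qed.

Lemma saD x y : sa x -> sa y -> sa (x + y).
Proof. by rewrite /sa cstarD => -> ->. Qed.

Lemma saN x : sa x -> sa (- x).
Proof. by rewrite /sa cstarN => ->. Qed.

Lemma saB x y : sa x -> sa y -> sa (x - y).
Proof. by move=> sx /saN; exact: saD. Qed.

Lemma saZr r x : sa x -> sa (r%:C *: x).
Proof. by rewrite /sa cstarZr => ->. Qed.

Lemma sa_sqr x : sa x -> sa (x ** x).
Proof. by move=> sx; rewrite /sa cstarM sx. Qed.

Lemma saM x y : sa x -> sa y -> x ** y = y ** x -> sa (x ** y).
Proof. by move=> sx sy xy; rewrite /sa cstarM sx sy. Qed.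

Lemma sa_eq0C x y : sa x -> sa y -> x ** y = 0 -> y ** x = 0.
Proof. by move=> sx sy h; rewrite -[y]sy -[x]sx -cstarM h cstar0. Qed.

Lemma ncvg_sa (u : nat -> A) z : (forall n, sa (u n)) -> ncvg u z -> sa z.
Proof.
move=> su uz; apply: ncvg_unique (uz).
by have := ncvg_star uz; congr ncvg; apply: funext => n; rewrite su.
Qed.

(** Majorant method: the increments of the iteration are dominated by those of the scalar iteration
    [eta], where [w] is replaced by [1]; it increases and stays below [1]. The last two clauses
    reflect that [y] is a limit of polynomials in [w] without constant term. *)
Lemma contraction_sqrt w : sa w -> nrm w <= 1 ->
  exists y, [/\ sa y, nrm y <= 1, y ** y = y + y - w,
    forall u, w ** u = 0 -> y ** u = 0 & forall u, w ** u = u ** w -> y ** u = u ** y].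
Proof.
move=> sw w1.
pose f x := (2^-1)%:C *: (w + x ** x); pose u n := iter n f 0.
pose eta n : R := iter n (fun t => 2^-1 * (1 + t ^+ 2)) 0.
have uS n : u n.+1 = f (u n) by [].
have etaS n : eta n.+1 = 2^-1 * (1 + eta n ^+ 2) by [].
have eta_ge0 n : 0 <= eta n.
  by elim: n => //= n IH; rewrite mulr_ge0// addr_ge0// sqr_ge0.
have eta_le1 n : eta n <= 1.
  elim: n => [|n IH]; first by rewrite /eta /= ler01.
  by rewrite /eta /= -/(eta n); have := eta_ge0 n; nra.
have u_eta n : nrm (u n) <= eta n.
  elim: n => [|n IH]; first by rewrite /= nrm0.
  rewrite /u /= -/(u n) -/(eta n) /f nrmZr ger0_norm ?invr_ge0//.
  apply: ler_wpM2l; first by rewrite invr_ge0.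
  apply: le_trans (nrmD _ _) _; apply: lerD => //.
  by apply: le_trans (nrmM _ _) _; rewrite expr2 ler_pM// nrm_ge0.
have du n : nrm (u n.+1 - u n) <= eta n.+1 - eta n.
  elim: n => [|n IH].
    rewrite /u/eta /= subr0 expr0n /= addr0 mulr1 subr0 /f cmul0l addr0 nrmZr.
    by rewrite ger0_norm ?invr_ge0// ler_piMr// invr_ge0.
  (* Difference of squares without commutativity: [a^2 - b^2 = a (a - b) + (a - b) b]. *)
  have -> : u n.+2 - u n.+1 = (2^-1)%:C *:
      (u n.+1 ** (u n.+1 - u n) + (u n.+1 - u n) ** u n).
    by rewrite (uS n.+1) {2}(uS n) /f !cmulBl !cmulBr; module.
  have -> : eta n.+2 - eta n.+1 =
      2^-1 * (eta n.+1 * (eta n.+1 - eta n) + (eta n.+1 - eta n) * eta n).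
    by rewrite (etaS n.+1) {2}(etaS n); ring.
  rewrite nrmZr ger0_norm ?invr_ge0// ler_wpM2l ?invr_ge0//.
  apply: le_trans (nrmD _ _) _.
  by apply: lerD; apply: le_trans (nrmM _ _) _; rewrite ler_pM// ?nrm_ge0.
have [y uy] := ncvg_dominated eta_le1 du.
have u_le1 n : nrm (u n) <= 1 by apply: le_trans (u_eta n) _.
have y1 : nrm y <= 1 by exact: nrm_ncvg_le uy.
have fy : f y = y.
  apply: ncvg_unique (ncvg_shift uy); rewrite /f.
  apply: ncvgZ; apply: ncvgD (ncvg_cst _) _.
  move=> e e0; have [N hN] := uy _ (divr2_gt0 e0).
  exists N => n /hN h.
  have -> : u n ** u n - y ** y = u n ** (u n - y) + (u n - y) ** y.
    by rewrite cmulBl cmulBr; module.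
  have := nrmD (u n ** (u n - y)) ((u n - y) ** y).
  have := nrmM (u n) (u n - y); have := nrmM (u n - y) y.
  by have := u_le1 n; have := nrm_ge0 (u n - y); nra.
(* Self-adjointness, annihilation and commutation hold at [0] and survive [f] and limits, so they
   pass to [y]. *)
have ind (P : A -> Prop) : P 0 -> (forall x, P x -> P (f x)) ->
    (forall v z, (forall n, P (v n)) -> ncvg v z -> P z) -> P y.
  move=> P0 Pf Pl; apply: Pl uy => n; elim: n => // n; exact: Pf.
exists y; split=> //.
- apply: ind => [|x sx|v z]; [exact: cstar0 | | exact: ncvg_sa].
  by apply: saZr; apply: saD => //; exact: sa_sqr.
- have -> : y + y = f y + f y by rewrite fy.
  have h1 : 2^-1 + 2^-1 = 1 :> R by lra.
  by rewrite /f -scalerDl -rmorphD /= h1 scale1r addrC addKr.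
- move=> v wv; apply: (ind (fun t => t ** v = 0)) => [|x xv|z l zv zl]; first exact: cmul0l.
    by rewrite /f cmulZl cmulDl wv -cmulA xv cmul0r addr0 scaler0.
  apply: (ncvg_unique (ncvgMr v zl)).
  by rewrite (funext zv); exact: ncvg_cst.
- move=> v wv; apply: (ind (fun t => t ** v = v ** t)) => [|x xv|z l zv zl].
    by rewrite cmul0l cmul0r.
    by rewrite /f cmulZl cmulZr cmulDl cmulDr wv -cmulA xv !cmulA xv.
  apply: (ncvg_unique (ncvgMr v zl)).
  by rewrite (funext zv); exact: ncvgMl.
Qed.
End CStarBasics.

Ltac cexpand :=
  rewrite ?(cmulDl, cmulDr, cmulNl, cmulNr, cmulZl, cmulZr, cmulA, cmul0l, cmul0r).

(** * Unitaries and piecewise linear functions of a self-adjoint element *)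

Section Tent.
Context {R : realType} {A : cstarAlgType R}.
Implicit Types (x y z u w d e : A) (k c : R[i]) (r : R).

(* With [b := 1 - y], [d^2 + b^2 = 1], so that [v := d + i b] is unitary and
   [2 d^2 - 1] and [2 d b] are the real and imaginary parts of [v^2].  Since the
   algebra may lack a unit, [v] only acts by left multiplication. *)
Lemma unitary_part d : sa d -> nrm d <= 1 -> exists y,
  [/\ sa y, d ** y = y ** d & forall u, d ** u = 0 -> y ** u = 0] /\
  [/\ forall x, nrm (x - 2 *: (d ** d ** x)) <= nrm x,
      nrm (2 *: (d - d ** y)) <= 1 &
      (2 *: (d - d ** y)) ** (2 *: (d - d ** y)) = 4 *: (d ** d - d ** d ** d ** d)].
Proof.
move=> sd d1.
have [|y [sy y1 yy yker ycom]] := contraction_sqrt (sa_sqr sd).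
  by rewrite nrm_sqr// expr_le1// nrm_ge0.
have yd : y ** d = d ** y by apply: ycom; rewrite cmulA.
exists y; split; first by split=> // u du; apply: yker; rewrite -cmulA du cmul0r.
have zyy z : z ** y ** y = z ** y + z ** y - z ** d ** d.
  by rewrite -cmulA yy; cexpand.
have zyd z : z ** y ** d = z ** d ** y by rewrite -!cmulA yd.
(* Left multiplication by [d + c b]. For [c = i] or [c = - i] the cross terms of
   [cstar (V c x) ** V c x] cancel, and [d^2 + b^2 = 1] leaves [cstar x ** x]. *)
pose V c x := d ** x + c *: (x - y ** x).
have isoV c x : conjc c = - c -> c * c = -1 -> nrm (V c x) = nrm x.
  move=> cJ cc; apply/eqP; rewrite -(@eqrXn2 _ 2) ?nrm_ge0// -!nrm_cstar_mul.
  apply/eqP; congr nrm; rewrite /V !(cstarD, cstarN, cstarZ, cstarM) sd sy cJ.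
  cexpand; rewrite !zyy !zyd; cexpand; mod_eqs; ring: cc.
have [j [cJ cc nj]] : exists j : R[i], [/\ conjc j = - j, j * j = -1 & complex.Re `|j| = 1].
  exists 'i%C; split.
  - by apply/eqP; rewrite eq_complex /= oppr0 !eqxx.
  - by rewrite -expr2 sqr_i.
  - by rewrite normc_def /= expr0n expr1n add0r sqrtr1.
have cJ' : conjc (- j) = - - j by rewrite rmorphN /= cJ.
have cc' : (- j) * (- j) = -1 by rewrite mulrNN.
have nVV x : nrm (V j (V j x)) = nrm x /\ nrm (V (- j) (V (- j) x)) = nrm x.
  by rewrite !isoV.
have nrm2 x : nrm (2 *: x) = 2 * nrm x.
  by rewrite -(rmorph_nat (real_complex R)) nrmZr ger0_norm.
have k1 x : nrm (2 *: (d - d ** y) ** x) <= nrm x.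
  have [n1 n2] := nVV x.
  rewrite -(ler_pM2l (ltr0Sn R 1)) -nrm2.
  (* The imaginary part of [v^2], from [v^2 - (d - i b)^2 = 4 i d b]. *)
  have -> : 2 *: (2 *: (d - d ** y) ** x) =
      (- j) *: (V j (V j x) - V (- j) (V (- j) x)).
    rewrite /V; cexpand; rewrite yd yy; cexpand; mod_eqs; ring: cc.
  rewrite nrmZ normrN nj mul1r.
  by apply: le_trans (nrmB _ _) _; rewrite n1 n2; lra.
split.
- move=> x; have [n1 n2] := nVV x.
  rewrite -(ler_pM2l (ltr0Sn R 1)) -nrm2 -nrmN.
  have -> : - (2 *: (x - 2 *: (d ** d ** x))) =
      V j (V j x) + V (- j) (V (- j) x).
    rewrite /V; cexpand; rewrite yd yy; cexpand; mod_eqs; ring: cc.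
  by apply: le_trans (nrmD _ _) _; rewrite n1 n2; lra.
- set k := 2 *: _; have sk : sa k.
    rewrite /k -(rmorph_nat (real_complex R)); apply: saZr; apply: saB => //.
    exact: saM.
  (* Left multiplication by [k] is a contraction; applied to [k] itself it gives
     [nrm k ^+ 2 <= nrm k]. *)
  have [->|k0] := eqVneq k 0; first by rewrite nrm0 ler01.
  have := k1 k; rewrite -/k nrm_sqr// expr2 -[X in _ <= X]mulr1.
  by rewrite ler_pM2l// nrm_gt0.
- cexpand; rewrite -[d ** y ** d]cmulA yd cmulA !zyy; cexpand; module.
Qed.

(* Functionally, [s] takes values in [0, 2] and [y] is the tent [min s (2 - s)]. *)
Lemma tent e : sa e -> e != 0 -> exists s y,
  [/\ sa s, sa y, s ** y = y ** s, nrm s = 2 & nrm y <= 1] /\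
  [/\ s ** s - y ** y = 2 *: (s - y),
      forall u, e ** u = 0 -> s ** u = 0 & forall u, e ** u = 0 -> y ** u = 0].
Proof.
move=> se e0; pose d := (nrm e)^-1%:C *: e.
have sd : sa d by exact: saZr.
have nd : nrm d = 1.
  by rewrite nrmZr ger0_norm ?invr_ge0 ?nrm_ge0// mulVf// nrm_eq0.
have du u : e ** u = 0 -> d ** u = 0 by rewrite cmulZl => ->; rewrite scaler0.
have [|y' [[sy' dy' y'ker] [_ k1 kk]]] := unitary_part sd; first by rewrite nd.
have sk : sa (2 *: (d - d ** y')).
  rewrite -(rmorph_nat (real_complex R)); apply: saZr; apply: saB => //.
  exact: saM.
set k := 2 *: (d - d ** y') in k1 kk sk.
(* With [s = 2 d^2], [k^2 = 4 d^2 (1 - d^2) = s (2 - s)]. Hence [(1 - y)^2 = (1 - s)^2], and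
   functionally [y = 1 - |1 - s|]. *)
have [|y [sy y1 yy yker ycom]] := contraction_sqrt (sa_sqr sk).
  by rewrite nrm_sqr// expr_le1// nrm_ge0.
exists (2 *: (d ** d)), y; split; split=> //.
- by rewrite -(rmorph_nat (real_complex R)); apply/saZr/sa_sqr.
- by apply/esym/ycom; rewrite kk; cexpand; module.
- by rewrite -(rmorph_nat (real_complex R)) nrmZr ger0_norm// nrm_sqr// nd; lra.
- by rewrite yy kk; cexpand; module.
- by move=> u /du h; rewrite cmulZl -cmulA h cmul0r scaler0.
- move=> u /du h; apply: yker.
  by rewrite kk cmulZl cmulBl -!cmulA h !cmul0r subrr scaler0.
Qed.

End Tent.

(** * Minimal projections *)

Lemma lipschitz_within (R : realType) (V : normedModType R) (D : set V)
    (f : V -> R) (c : R) :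
  (forall x y, D x -> D y -> `|f x - f y| <= c * `|x - y|) ->
  {within D, continuous f}.
Proof.
move=> fc; apply/subspace_continuousP => x Dx; apply/cvgrPdist_lt => e e0.
have c0 : 0 < `|c| + 1 by rewrite ltr_wpDl.
near=> y.
have Dy : D y by near: y; exact: withinT.
have : `|x - y| < e / (`|c| + 1).
  near: y; apply: cvg_within; apply: cvgr_dist_lt => //; rewrite divr_gt0//.
rewrite ltr_pdivlMr// => h; apply: le_lt_trans (fc _ _ Dx Dy) _.
apply: le_lt_trans h; rewrite mulrC; apply: ler_wpM2l => //.
by rewrite ler_wpDr// ler_norm.
Unshelve. all: by end_near. Qed.

Section MinimalProjections.
Context {R : realType} {A : cstarAlgType R}.
Implicit Types (x y z u w d e p : A) (k c : R[i]) (r : R).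

Lemma cmul_star_eq0 x : cstar x ** x = 0 -> x = 0.
Proof.
move=> h; apply: nrm_le0; have := nrm_cstar_mul x; rewrite h nrm0.
by move=> /esym/eqP; rewrite sqrf_eq0 => /eqP ->.
Qed.

Lemma cmul_annihilates x : (forall u, x ** u = 0) -> x = 0.
Proof.
by move=> h; rewrite -[x]cstarK (cmul_star_eq0 (x := cstar x)) ?cstar0// cstarK.
Qed.

(** For self-adjoint elements: the support of [x] lies in that of [e]. Annihilators express this
    inside the algebra, which may lack support projections. *)
Definition dominates e x := forall u, e ** u = 0 -> x ** u = 0.

Lemma dominates_trans e x y : dominates e x -> dominates x y -> dominates e y.
Proof. by move=> ex xy u /ex/xy. Qed.

Lemma dominatesD e x y : dominates e x -> dominates e y -> dominates e (x + y).
Proof. by move=> ex ey u eu; rewrite cmulDl ex// ey// addr0. Qed.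

Lemma dominatesZ e k x : dominates e x -> dominates e (k *: x).
Proof. by move=> ex u eu; rewrite cmulZl ex// scaler0. Qed.

Lemma dominatesB e x y : dominates e x -> dominates e y -> dominates e (x - y).
Proof. by move=> ex ey u eu; rewrite cmulBl ex// ey// subr0. Qed.

Lemma dominatesM e x y : dominates e y -> dominates e (x ** y).
Proof. by move=> ey u eu; rewrite -cmulA ey// cmul0r. Qed.

Lemma dominates_orth x y x' y' : sa x -> sa y -> sa x' -> sa y' ->
  dominates x x' -> dominates y y' -> x ** y = 0 -> x' ** y' = 0.
Proof.
move=> sx sy sx' sy' xx' yy' /xx' h.
by apply: sa_eq0C => //; apply: yy'; exact: sa_eq0C.
Qed.

Definition projection p := sa p /\ p ** p = p.

(** [p] annihilates every [u - p ** u], hence so does [y]: domination by a projection is membership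
    in the corner [p A p]. *)
Lemma dominates_projection p y : projection p -> sa y -> dominates p y ->
  y ** p = y /\ p ** y = y.
Proof.
move=> [sp pp] sy py.
have yp : y ** p = y.
  apply/esym/eqP; rewrite -subr_eq0; apply/eqP/cmul_annihilates => u.
  rewrite cmulBl -cmulA -cmulBr; apply: py.
  by rewrite cmulBr cmulA pp subrr.
by split=> //; rewrite -[in RHS]sy -[in RHS]yp cstarM sp sy.
Qed.

Lemma nrm_projection p : projection p -> p != 0 -> nrm p = 1.
Proof.
move=> [sp pp] p0; have := nrm_sqr sp; rewrite pp expr2 -{1}[nrm p]mulr1.
by move=> /mulfI <-//; rewrite nrm_eq0.
Qed.

Definition irreducible e := forall x y, sa x -> sa y ->
  dominates e x -> dominates e y -> x ** y = 0 -> x = 0 \/ y = 0.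

Lemma irreducible_dominates e x : irreducible e -> dominates e x -> irreducible x.
Proof.
by move=> ie ex y z sy sz xy xz; apply: ie => //; exact: dominates_trans ex _.
Qed.

(** Functionally, [m = min s 1] and [z = 2 max (s - 1) 0], so [m] is [1] wherever [z] is nonzero. If
    [e] is irreducible, [z (s - s m) = 0] forces [s m = s]; then [z m = z] gives [y m = y], and so
    [m^2 = m]. *)
Lemma tent_eigenvector e : sa e -> e != 0 -> exists m z,
  [/\ sa m, sa z, z != 0, m ** z = z & nrm m <= 2] /\
  [/\ dominates e m, dominates e z & irreducible e -> projection m].
Proof.
move=> se e0; have [s [y [[ss sy sYs ns ny] [eq_sy es ey]]]] := tent se e0.
pose m := (2^-1)%:C *: (s + y); pose z := s - y.
have half2 : (2^-1)%:C * 2 = 1 :> R[i].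
  by rewrite -(rmorph_nat (real_complex R)) -rmorphM /= mulVf ?pnatr_eq0.
have sm : sa m by apply/saZr/saD.
have sz : sa z by exact: saB.
have z0 : z != 0.
  rewrite subr_eq0; apply/eqP => e_sy; move: ns ny; rewrite e_sy; lra.
have zm : z ** m = z.
  have -> : z ** m = (2^-1)%:C *: (s ** s - y ** y).
    by rewrite /z /m; cexpand; rewrite sYs; module.
  by rewrite eq_sy -/z scalerA half2 scale1r.
have mz : m ** z = z by rewrite -[RHS]sz -zm cstarM sm sz zm.
have em : dominates e m by apply/dominatesZ/dominatesD.
have ez : dominates e z by apply/dominatesB.
exists m, z; split; split=> //.
- rewrite /m nrmZr ger0_norm ?invr_ge0//.
  by have := nrmD s y; rewrite ns; lra.
move=> ie; split=> //.
have sms : s ** m = m ** s by rewrite /m; cexpand; rewrite sYs.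
have zs : z ** s = s ** z by rewrite /z; cexpand; rewrite sYs.
have smE : s ** m = s.
  case: (ie z (s - s ** m)) => //.
  - by apply: saB => //; exact: saM.
  - by apply: dominatesB => //; apply: dominatesM.
  - by rewrite cmulBr cmulA zs -cmulA zm subrr.
  - by move=> z0'; rewrite z0' eqxx in z0.
  - by move/eqP; rewrite subr_eq0 => /eqP <-.
have ymE : y ** m = y.
  by have := zm; rewrite /z cmulBl smE => /addrI/oppr_inj.
by rewrite {1}/m cmulZl cmulDl smE ymE.
Qed.

(** * The corner of an irreducible projection consists of scalars *)

Section Corner.
Variables (p : A) (pP : projection p) (p0 : p != 0) (ip : irreducible p).

(* [c := p - y] is the absolute value of [x]; as [(c - x)(c + x) = 0],
   irreducibility forces [c = x] or [c = - x]. *)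
Lemma corner_dichotomy x : sa x -> dominates p x -> nrm x <= 1 ->
  nrm (p - 2 *: x) <= 1 \/ nrm (p + 2 *: x) <= 1.
Proof.
move=> sx px x1; have np := nrm_projection pP p0; have [sp pp] := pP.
have pd : dominates p p by [].
have [xp _] := dominates_projection pP sx px.
have nrm2 v : nrm (2 *: v) = 2 * nrm v :> R.
  by rewrite -(rmorph_nat (real_complex R)) nrmZr ger0_norm.
(* The real part of [v^2] is contractive; here it acts on [p], the unit of the corner. *)
have bound d : sa d -> dominates p d -> nrm d <= 1 -> nrm (p - 2 *: (d ** d)) <= 1.
  move=> sd dp d1; have [_ [_ [+ _ _]]] := unitary_part sd d1.
  by move=> /(_ p); rewrite -cmulA; have [-> _] := dominates_projection pP sd dp; rewrite np.
have sw : sa (p - x ** x) by apply: saB => //; exact: sa_sqr.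
have [|y [sy y1 yy yker ycom]] := contraction_sqrt sw.
  have := bound x sx px x1; have := nrmD ((2^-1)%:C *: p) ((2^-1)%:C *: (p - 2 *: (x ** x))).
  have -> : (2^-1)%:C *: p + (2^-1)%:C *: (p - 2 *: (x ** x)) = p - x ** x.
    mod_eqs; last by rewrite -(rmorph_nat (real_complex R)); field.
    by rewrite -(rmorph_nat (real_complex R)); field.
  by rewrite !nrmZr ger0_norm ?invr_ge0// np; lra.
have py : dominates p y.
  by move=> u pu; apply: yker; apply: dominatesB pu => //; exact: dominatesM.
have [yp pYy] := dominates_projection pP sy py.
have [c cE] : exists c : A, c = p - y by exists (p - y).
have sc : sa c by rewrite cE; exact: saB.
have pc : dominates p c by rewrite cE; exact: dominatesB.
have cc : c ** c = x ** x.
  by rewrite cE; cexpand; rewrite pp yp pYy yy; module.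
have xc : x ** c = c ** x.
  have [_ pxx] := dominates_projection pP sx px.
  by rewrite cE; cexpand; rewrite xp pxx ycom// cmulBl cmulBr cmulA xp pxx.
have c1 : nrm c <= 1.
  by rewrite -(@expr_le1 _ 2) ?nrm_ge0// -nrm_sqr// cc nrm_sqr// expr_le1// nrm_ge0.
(* A second root exhibits [c] as the square of [p - y'], to which [bound] applies. *)
have c2 : nrm (p - 2 *: c) <= 1.
  have [y' [sy' y'1 yy' yker' _]] := contraction_sqrt sy y1.
  have py' : dominates p y' by move=> u /py/yker'.
  have [yp' pYy'] := dominates_projection pP sy' py'.
  have dd : (p - y') ** (p - y') = c.
    by cexpand; rewrite pp yp' pYy' yy' cE; module.
  rewrite -dd; apply: bound; [exact: saB | exact: dominatesB |].
  by rewrite -(@expr_le1 _ 2) ?nrm_ge0// -nrm_sqr ?dd//; exact: saB.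
case: (@ip (c - x) (c + x)) => //.
- exact: saB.
- exact: saD.
- exact: dominatesB.
- exact: dominatesD.
- by cexpand; rewrite cc xc; module.
- by move=> /eqP; rewrite subr_eq0 => /eqP <-; left.
- by move=> /eqP; rewrite addr_eq0 => /eqP cx; right; rewrite -[x]opprK -cx scalerN.
Qed.

(** The dichotomy for [x] divided by its norm, scaled by [nrm x / 2]; thus [r] is plus or minus
    [nrm x / 2]. *)
Lemma corner_halving x : sa x -> dominates p x ->
  exists r, nrm (x - r%:C *: p) <= nrm x / 2.
Proof.
move=> sx px; have [->|x0] := eqVneq x 0.
  by exists 0; rewrite scale0r subr0 nrm0 mul0r.
have n0 : nrm x != 0 by rewrite nrm_eq0.
pose t := (nrm x)^-1%:C *: x.
have nt : nrm t <= 1 by rewrite nrmZr ger0_norm ?invr_ge0 ?nrm_ge0// mulVf.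
have xt : x = (nrm x)%:C *: t by rewrite scalerA -rmorphM divff// scale1r.
have fact (q : A) (s : R[i]) : nrm q <= 1 ->
   x - (nrm x / 2)%:C *: (s *: p) = (nrm x / 2)%:C *: q ->
   nrm (x - (nrm x / 2)%:C *: (s *: p)) <= nrm x / 2.
  move=> q1 ->; rewrite nrmZr ger0_norm ?divr_ge0 ?nrm_ge0//.
  by rewrite ler_piMr// divr_ge0// nrm_ge0.
have e2 : (nrm x / 2)%:C * 2 = (nrm x)%:C :> R[i].
  by rewrite -(rmorph_nat (real_complex R)) -rmorphM /= divfK// pnatr_eq0.
case: (corner_dichotomy (saZr _ sx : sa t) (dominatesZ _ px) nt) => h.
- exists (nrm x / 2); rewrite -[p]scale1r; apply: (@fact (- (p - 2 *: t))).
    by rewrite nrmN.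
  by rewrite {1}xt -e2; module.
- exists (- (nrm x / 2)); have := @fact (p + 2 *: t) (-1) h.
  rewrite scaleN1r scalerN rmorphN scaleNr; apply.
  by rewrite {1}xt -e2; module.
Qed.

(* The multiple of [p] closest to [x] exists by compactness, and halving shows
   that its distance to [x] is zero. *)
Lemma corner_real x : sa x -> dominates p x -> exists r, x = r%:C *: p.
Proof.
move=> sx px; have np := nrm_projection pP p0.
(* Wide enough to contain the improved multiple [r0 + r] found below, whose modulus is at most [3/2]
   times [nrm x]. *)
pose M := 2 * nrm x; have M0 : 0 <= M by rewrite mulr_ge0 ?nrm_ge0.
have [||r0 rM rmin] := @EVT_min _ (fun r => nrm (x - r%:C *: p)) (- M) M.
- by lra.
- apply: (@lipschitz_within _ _ _ _ 1) => a b _ _.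
  apply: le_trans (nrm_lip _ _) _.
  have -> : x - a%:C *: p - (x - b%:C *: p) = (b - a)%:C *: p.
    by rewrite rmorphB /=; module.
  by rewrite nrmZr np mulr1 mul1r distrC.
have [||r hr] := @corner_halving (x - r0%:C *: p).
- by apply: saB => //; apply: saZr; case: pP.
- by apply: dominatesB => //; apply: dominatesZ.
exists r0; apply/eqP; rewrite -subr_eq0; apply/eqP/nrm_le0.
have r00 : nrm (x - r0%:C *: p) <= nrm x.
  have := rmin 0; rewrite scale0r subr0; apply.
  by rewrite in_itv /=; lra.
have eD : x - r0%:C *: p - r%:C *: p = x - (r0 + r)%:C *: p.
  by rewrite rmorphD /=; module.
rewrite eD in hr.
have : nrm (x - r0%:C *: p) <= nrm (x - (r0 + r)%:C *: p).
  apply: rmin; rewrite in_itv /= -ler_norml.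
  have := nrm_dist ((r0 + r)%:C *: p) x 0; rewrite !subr0 nrmZr np mulr1 nrm_sym.
  have := nrm_ge0 x; rewrite /M; lra.
have := nrm_ge0 (x - r0%:C *: p); lra.
Qed.

(** The real case is applied to the real and imaginary parts, up to real factors. Domination sees
    one side only, hence the two hypotheses. *)
Lemma corner_scalar x : dominates p x -> dominates p (cstar x) -> exists k, x = k *: p.
Proof.
move=> px psx.
have [j [cJ jj]] : exists j : R[i], conjc j = - j /\ j * j = -1.
  exists 'i%C; split; last by rewrite -expr2 sqr_i.
  by apply/eqP; rewrite eq_complex /= oppr0 !eqxx.
have [||a ha] := @corner_real (x + cstar x).
- by rewrite /sa cstarD cstarK addrC.
- exact: dominatesD.
have [||b hb] := @corner_real (j *: (x - cstar x)).
- by rewrite /sa cstarZ cJ cstarB cstarK; module.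
- by apply/dominatesZ/dominatesB.
exists (2^-1 * (a%:C - j * b%:C)).
have : x + x = (x + cstar x) - j *: (j *: (x - cstar x)).
  by mod_eqs; ring: jj.
rewrite ha hb => xx.
have -> : x = 2^-1 *: (x + x).
  by mod_eqs; field.
by rewrite xx; module.
Qed.

End Corner.
End MinimalProjections.

(** * From orthogonal sequences to dimension *)

Section SpanningFamilies.
Context {K : fieldType} {V : lmodType K}.

Definition spanning (I : finType) (v : I -> V) :=
  forall x, exists c : I -> K, x = \sum_i c i *: v i.

Lemma minimal_spanning_free n (v : 'I_n -> V) : spanning v ->
  (forall m (u : 'I_m -> V), spanning u -> (n <= m)%N) ->
  forall c, \sum_i c i *: v i = 0 -> forall i, c i = 0.
Proof.
case: n v => [|n] v sv nmin c c0 i; first by case: i.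
apply/eqP/negP => /negP ci.
suff /nmin : spanning (fun j => v (lift i j)) by rewrite ltnn.
move=> x; have [a ->] := sv x.
exists (fun j => a (lift i j) - a i / c i * c (lift i j)).
transitivity (\sum_j a j *: v j - (a i / c i) *: (\sum_j c j *: v j)).
  by rewrite c0 scaler0 subr0.
rewrite (bigD1_ord i) //= [X in _ - _ *: X](bigD1_ord i) //= scalerDr scalerA divfK//.
rewrite opprD addrACA subrr add0r scaler_sumr -sumrB.
by apply: eq_bigr => j _; rewrite scalerBl scalerA.
Qed.

(** A spanning family of least size is free, so taking combinations is a linear bijection from row
    vectors; [Vector.axiom] asks for its inverse. *)
Lemma spanning_finite_dimensional (I : finType) (v : I -> V) :
  spanning v -> finite_dimensional V.
Proof.
move=> sv.
pose P n := `[< exists u : 'I_n -> V, spanning u >].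
have exP : exists n, P n.
  exists #|I|; apply/asboolP; exists (fun i => v (enum_val i)) => x.
  have [c ->] := sv x; exists (fun i => c (enum_val i)).
  by rewrite (reindex (@enum_val I predT)) //; exact/onW_bij/enum_val_bij.
case: (ex_minnP exP) => n /asboolP [u su] nmin.
have free_u := minimal_spanning_free su.
pose f (r : 'rV[K]_n) := \sum_i r 0 i *: u i.
have fB a r s : f (a *: r + s) = a *: f r + f s.
  rewrite /f scaler_sumr -big_split; apply: eq_bigr => i _.
  by rewrite !mxE scalerDl scalerA.
have f_inj r s : f r = f s -> r = s.
  move=> frs; apply/rowP => i; apply/eqP; rewrite -subr_eq0; apply/eqP.
  have := free_u _ (fun i => r 0 i - s 0 i); apply=> [m w sw|].
    by apply: nmin; apply/asboolP; exists w.
  under eq_bigr do rewrite scalerBl.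
  by rewrite sumrB -/(f r) -/(f s) frs subrr.
have /choice [g fg] : forall x, exists r, f r = x.
  move=> x; have [c ->] := su x; exists (\row_i c i).
  by apply: eq_bigr => i _; rewrite mxE.
exists n; constructor; exists g.
- by move=> a x y; apply: f_inj; rewrite fB !fg.
- by exists f => [x|r]; [exact: fg | apply: f_inj; rewrite fg].
Qed.

End SpanningFamilies.

Section OrthogonalSequences.
Context {R : realType} {A : cstarAlgType R}.
Implicit Types (x y z u w d e p q : A) (s : seq A).

Definition orthogonal_sequence (e : nat -> A) :=
  (forall n, sa (e n) /\ e n != 0) /\
  (forall n m, n <> m -> e n ** e m = 0).

Lemma orthogonal_sequenceP (e : nat -> A) :
  (forall n, sa (e n) /\ e n != 0) ->
  (forall n m, (n < m)%N -> e n ** e m = 0) -> orthogonal_sequence e.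
Proof.
move=> h1 h2; split=> // n m nm.
case: (ltngtP n m) => // [|mn]; first exact: h2.
by apply: sa_eq0C; [exact: (h1 m).1 | exact: (h1 n).1 | exact: h2].
Qed.

(** Otherwise every nonzero self-adjoint element below [x] splits into two orthogonal ones. Keeping
    the first and splitting the second again, forever, produces an orthogonal sequence. *)
Lemma irreducible_below x : ~ (exists e : nat -> A, orthogonal_sequence e) ->
  sa x -> x != 0 -> exists y, [/\ sa y, y != 0, dominates x y & irreducible y].
Proof.
move=> noseq sx x0; apply: contrapT => /forallNP noy; apply: noseq.
pose P y := [/\ sa y, y != 0 & dominates x y].
have /choice [f fP] : forall y, exists uv : A * A, P y ->
    [/\ P uv.1, P uv.2, dominates y uv.1, dominates y uv.2 & uv.1 ** uv.2 = 0].
  move=> y; have [[sy y0 xy]|?] := pselect (P y); last by exists (0, 0).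
  have : ~ irreducible y by move=> iy; apply: (noy y).
  move=> /existsNP[u /existsNP[v /not_implyP[su /not_implyP[sv /not_implyP[yu]]]]].
  move=> /not_implyP[yv /not_implyP[uv /not_orP[/eqP u0 /eqP v0]]].
  exists (u, v) => _; split=> //; split=> //; exact: dominates_trans xy _.
pose S n := iter n (fun y => (f y).2) x.
have SP n : P (S n).
  by elim: n => [|n IH]; [split | have [] := fP _ IH].
have Sdom n k : dominates (S n) (S (n + k)%N).
  elim: k => [|k IH]; first by rewrite addn0.
  by rewrite addnS; apply: dominates_trans IH _; have [] := fP _ (SP (n + k)%N).
exists (fun n => (f (S n)).1); apply: orthogonal_sequenceP.
  by move=> n; have [[]] := fP _ (SP n).
move=> n m nm.
have [[su _ _] [sv _ _] _ _ uv] := fP _ (SP n).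
have [[su' _ _] _ mu' _ _] := fP _ (SP m).
apply: (dominates_orth su sv su su' _ _ uv) => //.
apply: dominates_trans mu'; rewrite -(subnKC nm); exact: (Sdom n.+1).
Qed.

Fixpoint minimal_family s : Prop :=
  if s is p :: s' then
    [/\ projection p, p != 0, irreducible p, forall q, q \in s' -> p ** q = 0
      & minimal_family s']
  else True.

Lemma minimal_family_sum s : minimal_family s ->
  projection (\sum_(p <- s) p) /\
  forall q, q \in s -> [/\ projection q, q != 0, irreducible q & (\sum_(p <- s) p) ** q = q].
Proof.
elim: s => [|p s IH] /=.
  by rewrite big_nil => _; split=> //; split; [exact: cstar0 | exact: cmul0l].
move=> [[sp pp] p0 ip ps /IH [[sP PP] hs]]; rewrite big_cons.
set P := \sum_(q <- s) q in sP PP hs *.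
have pP : p ** P = 0.
  by rewrite /P cmul_sumr big_seq big1// => q /ps.
have Pp := sa_eq0C sp sP pP.
split; first split; first exact: saD.
  by cexpand; rewrite pp PP pP Pp add0r addr0.
move=> q; rewrite inE => /predU1P [->|qs].
  by split=> //; rewrite cmulDl pp Pp addr0.
by have [? ? ? Pq] := hs q qs; split=> //; rewrite cmulDl ps// add0r.
Qed.

(** A nonzero self-adjoint [x] with [x P = 0], where [P] is the sum of a family, has below it an
    irreducible projection that extends the family. If this never stopped, the added projections
    would form an orthogonal sequence. *)
Lemma complete_minimal_family : ~ (exists e : nat -> A, orthogonal_sequence e) ->
  exists2 s, minimal_family s & forall x, x ** (\sum_(p <- s) p) = x.
Proof.
move=> noseq.
suff [s ms hs] : exists2 s, minimal_family s &
    forall x, sa x -> x ** (\sum_(p <- s) p) = 0 -> x = 0.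
  exists s => // x; have [[sP PP] _] := minimal_family_sum ms.
  set P := \sum_(p <- s) p in hs sP PP *.
  apply/esym/eqP; rewrite -subr_eq0; apply/eqP/cmul_star_eq0/hs.
    by rewrite /sa cstarM cstarK.
  by rewrite -cmulA cmulBl -cmulA PP subrr cmul0r.
apply: contrapT => /forall2NP nos; apply: (noseq).
have /choice [f fP] : forall s, exists p, minimal_family s -> minimal_family (p :: s).
  move=> s; have [ms|?] := pselect (minimal_family s); last by exists 0.
  have [//|/existsNP [x /not_implyP[sx /not_implyP[xP /eqP x0]]]] := nos s.
  have [y [sy y0 xy iy]] := irreducible_below noseq sx x0.
  have [p [z [[sp sz z0 pz _] [yp yz /(_ iy) pproj]]]] := tent_eigenvector sy y0.
  exists p => _; split=> //.
  - by apply: contraNneq z0 => p0; rewrite -pz p0 cmul0l.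
  - exact: irreducible_dominates iy yp.
  (* [q = P q], and [x P = 0] passes down through [y] to [p P = 0]. *)
  move=> q qs; have [_ /(_ q qs) [_ _ _ <-]] := minimal_family_sum ms.
  by rewrite cmulA yp ?cmul0l// xy.
pose S n := iter n (fun s => f s :: s) [::].
have SP n : minimal_family (S n) by elim: n => //= n /fP.
exists (fun n => f (S n)); apply: orthogonal_sequenceP.
  by move=> n; have [[]] := fP _ (SP n).
move=> n m nm.
have fS k : f (S n) \in S (n.+1 + k)%N.
  elim: k => [|k IH]; first by rewrite addn0 /S /= inE eqxx.
  by rewrite addnS /S /= inE -/(S _) IH orbT.
have [[sm _] _ _ orth _] := fP _ (SP m).
have [[sn _] _ _ _ _] := fP _ (SP n).
apply: sa_eq0C => //; apply: orth.
by rewrite -(subnKC nm).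
Qed.

(** If some [v = p x0 q] is nonzero, then [v (cstar v) = a p] with [a != 0], and [(cstar v) y = b q]
    for [y = p x q]; so [a y = v (cstar v) y = b v]. *)
Lemma minimal_corner_line p q :
  projection p -> p != 0 -> irreducible p ->
  projection q -> q != 0 -> irreducible q ->
  exists v, forall x, exists k : R[i], p ** x ** q = k *: v.
Proof.
move=> pP p0 ip qP q0 iq; have [sp pp] := pP; have [sq qq] := qP.
have [|/existsNP [x0 /eqP v0]] := pselect (forall x, p ** x ** q = 0).
  by move=> h; exists 0 => x; exists 0; rewrite h scaler0.
set v := p ** x0 ** q in v0; exists v => x; set y := p ** x ** q.
have pv : p ** v = v by rewrite /v !cmulA pp.
have py : p ** y = y by rewrite /y !cmulA pp.
have vq : v ** q = v by rewrite /v -!cmulA qq.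
have yq : y ** q = y by rewrite /y -!cmulA qq.
have dom (r z : A) : z ** r = z -> dominates r z.
  by move=> zr u ru; rewrite -zr -cmulA ru cmul0r.
have star (r z : A) : sa r -> r ** z = z -> cstar z ** r = cstar z.
  by move=> sr rz; rewrite -[in RHS]rz cstarM sr.
have [||a va] := @corner_scalar _ _ p pP p0 ip (v ** cstar v).
- by apply: dom; rewrite -cmulA (star _ _ sp pv).
- by apply: dom; rewrite cstarM cstarK -cmulA (star _ _ sp pv).
have [||b yb] := @corner_scalar _ _ q qP q0 iq (cstar v ** y).
- by apply: dom; rewrite -cmulA yq.
- by apply: dom; rewrite cstarM cstarK -cmulA vq.
have a0 : a != 0.
  apply: contraNneq v0 => a0; rewrite -(cstarK v) (cmul_star_eq0 (x := cstar v)) ?cstar0//.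
  by rewrite cstarK va a0 scale0r.
exists (a^-1 * b); rewrite -scalerA -[b *: v](_ : v ** (cstar v ** y) = _).
  by rewrite cmulA va cmulZl py scalerA mulVf// scale1r.
by rewrite yb cmulZr vq.
Qed.

Lemma no_orthogonal_sequence_finite_dimensional :
  ~ (exists e : nat -> A, orthogonal_sequence e) -> finite_dimensional A.
Proof.
move=> /complete_minimal_family [s ms sP].
have [[sS _] hs] := minimal_family_sum ms.
set P := \sum_(p <- s) p in sP sS.
(* Adjoints turn the right unit into a left one, so every [x] is the sum of its blocks [p x q]. *)
have Ps x : P ** x = x by rewrite -[RHS]cstarK -(sP (cstar x)) cstarM cstarK sS.
pose n := size s.
have /choice [v vP] : forall ij : 'I_n * 'I_n, exists v, forall x,
    exists k : R[i], s`_ij.1 ** x ** s`_ij.2 = k *: v.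
  move=> [i j] /=; have [? ? ? _] := hs _ (mem_nth 0 (ltn_ord i)).
  have [? ? ? _] := hs _ (mem_nth 0 (ltn_ord j)).
  exact: minimal_corner_line.
apply: (@spanning_finite_dimensional _ _ _ v) => x.
have /choice [c cP] : forall ij : 'I_n * 'I_n, exists k : R[i],
    s`_ij.1 ** x ** s`_ij.2 = k *: v ij by move=> ij; exact: vP.
have xE : x = \sum_(p <- s) \sum_(q <- s) p ** x ** q.
  rewrite -{1}(sP x) -{1}(Ps x) {1}/P !cmul_suml.
  by apply: eq_bigr => p _; exact: cmul_sumr.
exists c; rewrite {1}xE (big_nth 0) big_mkord.
under eq_bigr do rewrite (big_nth 0) big_mkord.
by rewrite pair_big /=; apply: eq_bigr => ij _; exact: cP.
Qed.

End OrthogonalSequences.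

(** * Fixed-point-free shift on a copy of c_0 *)

Section CZero.
Context {R : realType} {A : cstarAlgType R}.
Implicit Types (x y f g : A).

(* For orthogonal self-adjoint elements, [(x + y)^n = x^n + y^n] for [n = 2^k]. *)
Lemma nrm_add_orth x y (c : R) : sa x -> sa y -> x ** y = 0 ->
  nrm x <= c -> nrm y <= c -> nrm (x + y) <= c.
Proof.
have pow k : forall x y (c : R), sa x -> sa y -> x ** y = 0 ->
    nrm x <= c -> nrm y <= c -> nrm (x + y) ^+ (2 ^ k) <= 2 * c ^+ (2 ^ k).
  elim: k => [|k IH] {}x {}y {}c sx sy xy xc yc.
    by rewrite !expr1; have := nrmD x y; lra.
  have yx := sa_eq0C sx sy xy.
  rewrite expnS !exprM -nrm_sqr; last exact: saD.
  have -> : (x + y) ** (x + y) = x ** x + y ** y.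
    by cexpand; rewrite xy yx add0r addr0.
  apply: IH; try exact: sa_sqr.
  - by rewrite cmulA -[x ** x ** y]cmulA xy cmul0r cmul0l.
  - by rewrite nrm_sqr// ler_pXn2r ?nnegrE ?nrm_ge0// (le_trans (nrm_ge0 _) xc).
  - by rewrite nrm_sqr// ler_pXn2r ?nnegrE ?nrm_ge0// (le_trans (nrm_ge0 _) yc).
move=> sx sy xy xc yc; rewrite leNgt; apply/negP => cxy.
have c_ge0 : 0 <= c := le_trans (nrm_ge0 _) xc.
have [c0|c0] := eqVneq c 0.
  move: cxy; rewrite c0 in xc yc *.
  by rewrite (nrm_le0 xc) (nrm_le0 yc) addr0 nrm0 ltxx.
have {c_ge0}c0 : 0 < c by rewrite lt_neqAle eq_sym c0.
pose r := nrm (x + y) / c - 1.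
have r0 : 0 < r by rewrite subr_gt0 ltr_pdivlMr// mul1r.
have rE : nrm (x + y) = c * (1 + r) by rewrite /r; field; rewrite gt_eqF.
(* Bernoulli: as [2^k >= k], the power [(1 + r)^(2^k)] exceeds [2] once [k r > 1], against the bound
   [pow]. *)
have bern n : 1 + n%:R * r <= (1 + r) ^+ n.
  elim: n => [|n IH]; first by rewrite mul0r addr0 expr0.
  rewrite exprS -natr1.
  have n0 : 0 <= n%:R :> R by [].
  by nra.
have [k hk] : exists k, 1 < k%:R * r.
  exists (Num.bound r^-1); rewrite -ltr_pdivrMr// div1r.
  by apply: archi_boundP; rewrite invr_ge0 ltW.
have := pow k x y c sx sy xy xc yc; rewrite rE exprMn mulrC ler_pM2r ?exprn_gt0//.
have := bern (2 ^ k)%N.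
have : k%:R <= (2 ^ k)%N%:R :> R by rewrite ler_nat ltnW// ltn_expl.
by nra.
Qed.

Section UnitSequence.
Variable e : nat -> A.
Hypotheses (se : forall n, sa (e n)) (ne : forall n, nrm (e n) = 1)
           (orth : forall n m, n <> m -> e n ** e m = 0).
Implicit Types (l : nat -> R) (N : nat).

Definition comb l N := \sum_(n < N) (l n)%:C *: e n.

Lemma sa_comb l N : sa (comb l N).
Proof.
by apply: big_ind => [|x y|i _]; [exact: cstar0 | exact: saD | exact: saZr].
Qed.

Lemma combS l N : comb l N.+1 = comb l N + (l N)%:C *: e N.
Proof. by rewrite /comb big_ord_recr. Qed.

Lemma comb_mul_ge l N n : (N <= n)%N -> comb l N ** e n = 0.
Proof.
move=> Nn; rewrite cmul_suml big1// => i _; rewrite cmulZl orth ?scaler0//.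
by apply/eqP; rewrite ltn_eqF// (leq_trans (ltn_ord i)).
Qed.

(** Together with [comb_ge], this makes [comb] isometric from the finitely supported sequences with
    the sup norm. *)
Lemma comb_le l N (c : R) : 0 <= c -> (forall n, `|l n| <= c) -> nrm (comb l N) <= c.
Proof.
move=> c0 lc; elim: N => [|N IH]; first by rewrite /comb big_ord0 nrm0.
rewrite combS.
apply: nrm_add_orth IH _; [exact: sa_comb | exact: saZr | |].
  by rewrite cmulZr comb_mul_ge ?scaler0.
by rewrite nrmZr ne mulr1.
Qed.

(** Multiplication by [e n] isolates the coefficient [l n]. *)
Lemma comb_ge l N n : (n < N)%N -> `|l n| <= nrm (comb l N).
Proof.
move=> nN; have := nrmM (comb l N) (e n); rewrite ne mulr1.
rewrite cmul_suml (bigD1 (Ordinal nN)) //= big1 ?addr0 => [|i].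
  by rewrite cmulZl nrmZr nrm_sqr// ne expr1n mulr1.
by rewrite -val_eqE /= => /eqP ik; rewrite cmulZl orth ?scaler0.
Qed.

Lemma combB l l' N : comb l N - comb l' N = comb (fun n => l n - l' n) N.
Proof.
by rewrite /comb -sumrB; apply: eq_bigr => i _; rewrite rmorphB scalerBl.
Qed.

Lemma comb_widen l N N' : (forall n, (N <= n)%N -> l n = 0) -> (N <= N')%N ->
  comb l N = comb l N'.
Proof.
move=> l0 /subnKC <-; elim: (N' - N)%N => [|k IH]; first by rewrite addn0.
by rewrite addnS combS -IH l0 ?leq_addr// scale0r addr0.
Qed.

Definition admissible l N :=
  (forall n, 0 <= l n <= 1) /\ (forall n, (N <= n)%N -> l n = 0).

Definition shift l n := if n is k.+1 then l k else 1.

Lemma admissible_shift l N : admissible l N -> admissible (shift l) N.+1.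
Proof. by move=> [l01 l0]; split=> [[|n]|[|n]] //=; rewrite ?ler01 ?lexx//; exact: l0. Qed.

(** As a relation, the shift can be stated without reading coefficients off an element or fixing a
    cut-off [N]. *)
Definition shift_graph f g := exists l N,
  [/\ admissible l N, f = comb l N & g = comb (shift l) N.+1].

Lemma shift_graph_comb l N : admissible l N -> shift_graph (comb l N) (comb (shift l) N.+1).
Proof. by move=> lN; exists l, N. Qed.

Lemma shift_graph_common f g f' g' : shift_graph f g -> shift_graph f' g' ->
  exists l l' N, [/\ admissible l N, admissible l' N, f = comb l N,
    f' = comb l' N & g = comb (shift l) N.+1 /\ g' = comb (shift l') N.+1].
Proof.
move=> [l [N [[l01 l0] -> ->]]] [l' [N' [[l01' l0'] -> ->]]].
have NM := leq_maxl N N'; have NM' := leq_maxr N N'.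
exists l, l', (maxn N N'); split; last split.
- by split=> // n /(leq_trans NM); exact: l0.
- by split=> // n /(leq_trans NM'); exact: l0'.
- exact: comb_widen.
- exact: comb_widen.
- by apply: comb_widen => // -[|n]//=; exact: l0.
- by apply: comb_widen => // -[|n]//=; exact: l0'.
Qed.

(** The leading [1] cancels in the difference, whose other coefficients are those of [f - f'], moved
    by one place. *)
Lemma shift_graph_iso f g f' g' : shift_graph f g -> shift_graph f' g' ->
  nrm (g - g') <= nrm (f - f').
Proof.
move=> /shift_graph_common /[apply] -[l [l' [N [[_ l0] [_ l0'] -> -> [-> ->]]]]].
rewrite !combB; apply: comb_le; first exact: nrm_ge0.
move=> [|n] /=; first by rewrite subrr normr0 nrm_ge0.
have [Nn|nN] := leqP N n; first by rewrite l0// l0'// subrr normr0 nrm_ge0.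
exact: (comb_ge (fun n => l n - l' n)).
Qed.

Definition shift_dom x := forall d : R, 0 < d ->
  exists f g, shift_graph f g /\ nrm (f - x) < d.

(* The closure of [shift_graph] in the product. *)
Definition shift_rel x y := forall d : R, 0 < d ->
  exists f g, [/\ shift_graph f g, nrm (f - x) < d & nrm (g - y) < d].

(** The images of approximants of [x] form a Cauchy sequence because the shift is nonexpansive. The
    limit stays in the domain because each image can be shifted again. *)
Lemma shift_rel_exists x : shift_dom x -> exists y, shift_dom y /\ shift_rel x y.
Proof.
move=> Kx.
have inv0 n : 0 < n.+1%:R^-1 :> R by rewrite invr_gt0 ltr0n.
have /choice [fg fgP] : forall n, exists fg : A * A,
    shift_graph fg.1 fg.2 /\ nrm (fg.1 - x) < n.+1%:R^-1.
  by move=> n; have [f [g ?]] := Kx _ (inv0 n); exists (f, g).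
have invle n N : (N <= n)%N -> n.+1%:R^-1 <= N.+1%:R^-1 :> R.
  by move=> Nn; rewrite lef_pV2 ?posrE ?ltr0n// ler_nat.
have invlt d : 0 < d -> exists N, N.+1%:R^-1 < d :> R.
  by move=> d0; have [N] := ltr_add_invr d0; rewrite add0r; exists N.
have [|y gy] := @ncvg_complete _ _ (fun n => (fg n).2).
  move=> d d0; have [N hN] := invlt _ (divr2_gt0 d0).
  exists N => n Nn; have [Gn fn] := fgP n; have [GN fN] := fgP N.
  apply: le_lt_trans (shift_graph_iso Gn GN) _.
  have := nrm_dist (fg n).1 x (fg N).1; rewrite (nrm_sym x).
  have := lt_trans (lt_le_trans fn (invle _ _ Nn)) hN; have := lt_trans fN hN.
  by lra.
have xy : shift_rel x y.
  move=> d d0; have [N hN] := invlt _ d0; have [N' hN'] := gy _ d0.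
  have [G fx] := fgP (maxn N N').
  exists (fg (maxn N N')).1, (fg (maxn N N')).2; split=> //.
    by apply: lt_trans fx _; apply: le_lt_trans hN; apply: invle; rewrite leq_maxl.
  by apply: hN'; rewrite leq_maxr.
exists y; split=> // d /xy [f [g [[l [N [lN _ ->]]] _ gy']]].
exists (comb (shift l) N.+1), (comb (shift (shift l)) N.+2); split=> //.
exact/shift_graph_comb/admissible_shift.
Qed.

Lemma shift_rel_nonexpansive x y x' y' : shift_rel x y -> shift_rel x' y' ->
  nrm (y - y') <= nrm (x - x').
Proof.
move=> xy xy'; apply/ler_addgt0Pl => d d0.
have d4 : 0 < d / 4 by lra.
have [f [g [G fx gy]]] := xy _ d4; have [f' [g' [G' fx' gy']]] := xy' _ d4.
have := shift_graph_iso G G'.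
have := nrm_dist y g y'; have := nrm_dist g g' y'; rewrite (nrm_sym y g).
have := nrm_dist f x f'; have := nrm_dist x x' f'; rewrite (nrm_sym x' f').
by lra.
Qed.

(** A fixed point would have all coefficients [1], yet tending to [0]. Quantitatively, [f0] near [x]
    has no coefficient at [N0], while an almost fixed [f] near [x] has one of at least [1/2]
    there. *)
Lemma shift_rel_no_fixed_point x : ~ shift_rel x x.
Proof.
move=> xx; have q0 : 0 < 4^-1 :> R by lra.
have [f0 [g0 [G0 f0x _]]] := xx _ q0.
have [l0 [N0 [[_ l00] f0E _]]] := G0.
(* Chosen so that [N0 + 1] steps of size [2 d], starting from the leading [1], lose exactly
   [1/2]. *)
pose d : R := (4 * N0.+1%:R)^-1.
have d0 : 0 < d by rewrite invr_gt0 mulr_gt0 ?ltr0n.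
have dN : d * N0.+1%:R = 4^-1 by rewrite /d invfM -mulrA mulVf ?mulr1 ?pnatr_eq0.
have d4 : d <= 4^-1.
  by rewrite -dN -[X in X <= _]mulr1 ler_pM2l// ler1n.
have [f [g [G fx gx]]] := xx _ d0.
have nfg : nrm (g - f) < 2 * d.
  by have := nrm_dist g x f; rewrite (nrm_sym x); lra.
have nff0 : nrm (f - f0) < 2^-1.
  by have := nrm_dist f x f0; rewrite (nrm_sym x); lra.
have [l [N [[l01 lN] fE gE]]] := G.
have step n : `|shift l n - l n| <= 2 * d.
  apply: le_trans (ltW nfg).
  have -> : g - f = comb (fun n => shift l n - l n) (maxn N.+1 n.+1).
    rewrite -combB gE fE (@comb_widen l N (maxn N.+1 n.+1))//.
      congr (_ - _); apply: comb_widen; last exact: leq_maxl.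
      by move=> [|k]//=; exact: lN.
    by rewrite leq_max leqnSn.
  by apply: (comb_ge (fun n => shift l n - l n)); rewrite leq_max leqnn orbT.
have low n : 1 - (n.+1)%:R * (2 * d) <= l n.
  elim: n => [|n IH].
    by have := step 0%N; rewrite /= ler_norml => /andP[]; lra.
  have := step n.+1; rewrite /= ler_norml => /andP[_].
  by move: IH; rewrite -[n.+2%:R]natr1; lra.
have := low N0.
have : `|l N0| <= nrm (f - f0).
  have -> : f - f0 = comb (fun n => l n - l0 n) (maxn (maxn N N0) N0.+1).
    rewrite -combB fE f0E; congr (_ - _); apply: comb_widen => //.
      by rewrite -maxnA leq_maxl.
    by rewrite leq_max leq_maxr.
  have := @comb_ge (fun n => l n - l0 n) (maxn (maxn N N0) N0.+1) N0.
  by rewrite l00// subr0; apply; rewrite leq_maxr.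
rewrite (ger0_norm (andP (l01 N0)).1).
have -> : N0.+1%:R * (2 * d) = 2^-1 by rewrite mulrCA mulrC [_ * d]mulrC dN; lra.
by lra.
Qed.

Lemma convex_shift_dom : convex_set (shift_dom : set (convex_lmodType A)).
Proof.
move=> x y t /[!inE] Kx Ky d d0.
have [t0 t1] : 0 <= t%:num :> R[i] /\ t%:num <= 1 :> R[i] by split.
pose r : R := complex.Re t%:num.
have tE : t%:num = r%:C by rewrite RRe_real// ger0_real.
have r0 : 0 <= r by rewrite -ler0c -tE.
have r1 : r <= 1 by rewrite -lecR -tE.
have [f [g [G fx]]] := Kx d d0; have [f' [g' [G' fy]]] := Ky d d0.
have [l [l' [N [[l01 lN] [l01' lN'] fE fE' _]]]] := shift_graph_common G G'.
pose l2 n := r * l n + (1 - r) * l' n.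
have l2N : admissible l2 N.
  split=> n; last by move=> Nn; rewrite /l2 lN// lN'// !mulr0 addr0.
  by have := l01 n; have := l01' n; rewrite /l2; move=> /andP[? ?] /andP[? ?]; apply/andP; nra.
exists (comb l2 N), (comb (shift l2) N.+1); split; first exact: shift_graph_comb.
have -> : comb l2 N = r%:C *: f + (1 - r)%:C *: f'.
  rewrite fE fE' /comb !scaler_sumr -big_split; apply: eq_bigr => i _.
  by rewrite /l2 rmorphD !rmorphM /=; module.
have -> : conv t x y = r%:C *: x + (1 - r)%:C *: y.
  by rewrite rmorphB rmorph1 /= -tE.
have -> : r%:C *: f + (1 - r)%:C *: f' - (r%:C *: x + (1 - r)%:C *: y) =
   r%:C *: (f - x) + (1 - r)%:C *: (f' - y) by module.
apply: le_lt_trans (nrmD _ _) _; rewrite !nrmZr !ger0_norm ?subr_ge0//.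
(* A common bound keeps the inequality strict even when one of the weights vanishes. *)
have [c [fxc fyc cd]] : exists c, [/\ nrm (f - x) <= c, nrm (f' - y) <= c & c < d].
  exists (Num.max (nrm (f - x)) (nrm (f' - y))).
  by rewrite gt_max fx fy !le_max !lexx orbT.
by apply: le_lt_trans cd; nra.
Qed.

Lemma unit_sequence_no_fixed_point_property : ~ fixed_point_property A.
Proof.
move=> fpp.
have K0 : (shift_dom : set A) !=set0.
  exists (comb (fun=> 0) 0) => d d0; exists (comb (fun=> 0) 0), (comb (shift (fun=> 0)) 1).
  split; last by rewrite subrr nrm0.
  by apply: shift_graph_comb; split=> // n; rewrite lexx ler01.
have Kbnd : bounded_set (shift_dom : set A).
  exists 2%:C; split; first by rewrite complex_real.
  move=> r r2 x Kx; apply: le_trans (ltW r2); rewrite nrmE lecR.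
  have [f [g [[l [N [[l01 _] -> _]]] fx]]] := Kx 1 ltr01.
  have : nrm (comb l N) <= 1.
    by apply: comb_le => // n; rewrite ger0_norm; have /andP[] := l01 n.
  by have := nrm_dist x (comb l N) 0; rewrite !subr0 (nrm_sym x); lra.
have Kcl : closed (shift_dom : set A).
  apply/closed_approximable => x xK d d0.
  have [y Ky yx] := xK _ (divr2_gt0 d0); have [f [g [G fy]]] := Ky _ (divr2_gt0 d0).
  by exists f, g; split=> //; have := nrm_dist f y x; lra.
have /choice [M0 M0P] : forall x, exists y, shift_dom x -> shift_dom y /\ shift_rel x y.
  move=> x; have [/shift_rel_exists [y ?]|?] := pselect (shift_dom x); first by exists y.
  by exists 0.
have KM : set_fun (shift_dom : set A) (shift_dom : set A) M0.
  by move=> x /M0P [].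
have [|x Kx Mx] := fpp _ K0 Kbnd Kcl convex_shift_dom (mkfun_fun KM).
  move=> x y Kx Ky; rewrite nrm_le.
  exact: shift_rel_nonexpansive (M0P x Kx).2 (M0P y Ky).2.
apply: (@shift_rel_no_fixed_point x).
have M0x : M0 x = x by exact: Mx.
by have [_] := M0P x Kx; rewrite M0x.
Qed.

End UnitSequence.

Lemma fixed_point_property_no_orthogonal_sequence :
  fixed_point_property A -> ~ exists e : nat -> A, orthogonal_sequence e.
Proof.
move=> fpp [e [e0 orth]].
apply: (@unit_sequence_no_fixed_point_property (fun n => (nrm (e n))^-1%:C *: e n)) => //.
- by move=> n; apply: saZr; case: (e0 n).
- move=> n; rewrite nrmZr ger0_norm ?invr_ge0 ?nrm_ge0// mulVf// nrm_eq0.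
  by case: (e0 n).
- by move=> n m nm; rewrite cmulZl cmulZr orth// !scaler0.
Qed.

End CZero.

(** * Spectrum *)

Section Spectrum.
Context {R : realType} {A : cstarAlgType R}.
Implicit Types (a x y z e : A) (mu k : R[i]).

Lemma unitization_resolventE mu a :
  mu *: unitization_one - unitization_inj a = (- a, mu) :> unitization (A := A).
Proof.
by rewrite /unitization_one /unitization_inj; congr pair => /=;
  rewrite ?scaler0 ?add0r ?oppr0 ?addr0 ?[_ *: _]mulr1.
Qed.

(** A left inverse applied to [(mu - a) z = 0] would give [z = 0]; without a unit, the unitization
    acts on [z] in the same way. *)
Lemma spec_eigenvector a z mu : z != 0 -> a ** z = mu *: z -> spec a mu.
Proof.
move=> z0 az; have [[e eP]|noe] := pselect (exists e, is_unity e); [left|right].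
  exists e => // -[y [_ ye]]; move/eqP: z0; apply.
  rewrite -(eP z).1 -ye -cmulA cmulBl cmulZl (eP z).1 az subrr cmul0r //.
split; first by move=> e eP; apply: noe; exists e.
move=> -[[y k] [_]]; rewrite unitization_resolventE => -[] /=.
move=> /(congr1 (cmul^~ z)) + kmu; rewrite cmul0l => h.
move/eqP: z0; apply; rewrite -[z]scale1r -kmu -[RHS]oppr0 -h.
by cexpand; rewrite -cmulA az; cexpand; module.
Qed.

(** The inverse of [mu - a] is [mu^-1 + x]; the hypothesis on [x] is the part of this claim that
    makes sense without a unit. *)
Lemma not_spec_quasi_inverse a x mu : mu != 0 -> a ** x = x ** a ->
  mu *: x - a ** x = mu^-1 *: a -> ~ spec a mu.
Proof.
move=> mu0 ax e_x; have mm : mu * mu^-1 = 1 by rewrite divff.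
case=> [[e eP]|[_]]; apply.
  exists (mu^-1 *: e + x); have eP1 y := (eP y).1; have eP2 y := (eP y).2.
  split; cexpand; rewrite !(eP1, eP2) -?ax scalerA.
    rewrite mm scale1r -[RHS]addr0 -(subrr (mu^-1 *: a)) -{1}e_x; module.
  rewrite mulVf// scale1r -[RHS]addr0 -(subrr (mu^-1 *: a)) -{1}e_x; module.
exists (x, mu^-1); rewrite unitization_resolventE.
have h0 : - (a ** x) - mu^-1 *: a + mu *: x = 0.
  by rewrite -e_x; module.
split; rewrite /unitization_mul /unitization_one /=; congr pair; rewrite ?mulVf//.
- by rewrite -[RHS]h0; cexpand; module.
- by rewrite -[RHS]h0; cexpand; rewrite ax; module.
Qed.

(** The iterate is [a^(n+1)], and [x] is the polynomial quotient of [mu^n a - a^(n+1)] by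
    [mu - a]. *)
Lemma power_quotient a mu n : exists2 x, a ** x = x ** a &
  mu *: x - mu ^+ n *: a - a ** x = - iter n (cmul a) a.
Proof.
elim: n => [|n [x ax hx]].
  by exists 0; rewrite ?cmul0l ?cmul0r//= expr0; module.
exists (a ** x + mu ^+ n *: a).
  by cexpand; rewrite -[a ** x ** a]cmulA -ax cmulA.
rewrite /= -[RHS]cmulNr -hx exprS; cexpand.
by module.
Qed.

(** A linear dependence between [a], ..., [a^(n+1)] is a nonzero polynomial [p] with [a p(a) = 0].
    Outside [0] and the roots of [p], combining the quotients of powers yields
    [(mu - a) X = p(mu) a], so [X] divided by [mu p(mu)] is a quasi-inverse. *)
Lemma finite_spec_of_finite_dimensional a : finite_dimensional A ->
  finite_set (spec a).
Proof.
move=> [n [[f f_lin f_bij]]].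
pose F : {linear A -> 'rV[R[i]]_n} := HB.pack f (GRing.isLinear.Build _ _ _ _ f f_lin).
pose M := \matrix_(i < n.+1) F (iter i (cmul a) a).
have : kermx M != 0.
  rewrite kermx_eq0 -row_leq_rank -ltnNge ltnS; exact: rank_leq_col.
move=> /rowV0Pn [c /sub_kermxP cM c0].
have ca : \sum_(i < n.+1) c 0 i *: iter i (cmul a) a = 0.
  apply: (bij_inj f_bij); rewrite -[f]/(F : _ -> _) linear_sum linear0 -[RHS]cM.
  rewrite mulmx_sum_row; apply: eq_bigr => i _.
  by rewrite linearZ; congr (_ *: _); rewrite rowK.
pose p := \poly_(i < n.+1) c 0 (inord i).
have p0 : p != 0.
  apply: contraNneq c0 => p0; apply/eqP/rowP => i; rewrite mxE.
  by have := coef_poly n.+1 (fun i => c 0 (inord i)) i; rewrite -/p p0 coef0 ltn_ord inord_val.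
have pE mu : p.[mu] = \sum_(i < n.+1) c 0 i * mu ^+ i.
  by rewrite horner_poly; apply: eq_bigr => i _; rewrite inord_val.
have [r pr] := closed_field_poly_normal p.
apply: (@sub_finite_set _ _ [set` 0 :: r]); last exact: finite_seq.
move=> mu amu /=; rewrite inE; apply/negP => /negP /norP [mu0 mur].
have pmu : p.[mu] != 0.
  rewrite pr hornerZ mulf_neq0 ?lead_coef_eq0//.
  by rewrite -[_ == 0]/(root _ _) root_prod_XsubC.
have /choice [x xP] : forall i : 'I_n.+1, exists x, a ** x = x ** a /\
    mu *: x - mu ^+ i *: a - a ** x = - iter i (cmul a) a.
  by move=> i; have [x ? ?] := power_quotient a mu i; exists x.
pose X := \sum_i c 0 i *: x i.
have aX : a ** X = X ** a.
  rewrite cmul_sumr cmul_suml; apply: eq_bigr => i _.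
  by rewrite cmulZl cmulZr (xP i).1.
have pX : mu *: X - p.[mu] *: a - a ** X = 0.
  rewrite -[RHS]oppr0 -ca -sumrN pE cmul_sumr scaler_sumr scaler_suml.
  rewrite -!sumrB; apply: eq_bigr => i _.
  by rewrite -[RHS]scalerN -(xP i).2 cmulZr; module.
move: amu; apply: (@not_spec_quasi_inverse _ ((mu * p.[mu])^-1 *: X)) => //.
  by rewrite cmulZl cmulZr aX.
move/eqP: pX; rewrite addrAC subr_eq0 => /eqP pX.
rewrite cmulZr scalerA mulrC -scalerA -scalerBr pX scalerA invfM mulfVK//.
Qed.

End Spectrum.

(** * A self-adjoint element with infinite spectrum *)

Section InfiniteSpectrum.
Context {R : realType} {A : cstarAlgType R}.

Lemma orthogonal_sequence_infinite_spec (e : nat -> A) :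
  orthogonal_sequence e -> exists2 a : A, sa a & ~ finite_set (spec a).
Proof.
move=> [he orth].
have /choice [mz mzP] : forall n, exists mz : A * A,
    [/\ sa mz.1, sa mz.2, mz.2 != 0, mz.1 ** mz.2 = mz.2 & nrm mz.1 <= 2] /\
    dominates (e n) mz.1 /\ dominates (e n) mz.2.
  move=> n; have [se e0] := he n.
  by have [m [z [? [? ? _]]]] := tent_eigenvector se e0; exists (m, z).
pose m n := (mz n).1; pose z n := (mz n).2.
have mzD n k : n <> k -> m n ** z k = 0.
  move=> nk; have [[sm _ _ _ _] [em _]] := mzP n; have [[_ sz _ _ _] [_ ez]] := mzP k.
  exact: dominates_orth (he n).1 (he k).1 sm sz em ez (orth _ _ nk).
have [h [h0 hS h_inj]] : exists h : nat -> R,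
    [/\ forall n, 0 < h n, forall n, h n.+1 = h n / 2 & injective h].
  exists (fun n => 2^-1 ^+ n); split=> [n|n|i j].
  - by rewrite exprn_gt0// invr_gt0.
  - by rewrite exprS mulrC.
  - rewrite !exprVn => /invr_inj; rewrite -!natrX => /eqP.
    by rewrite eqr_nat eqn_exp2l// => /eqP.
pose u N := \sum_(n < N) (h n)%:C *: m n.
have su n : sa (u n).
  apply: big_ind => [|x y|i _]; [exact: cstar0 | exact: saD |].
  by apply: saZr; have [[]] := mzP i.
(* The increment of the majorant is [4 (h n - h n / 2) = 2 h n], which matches [nrm (m n) <= 2]. *)
have [||a ua] := @ncvg_dominated _ _ u (fun N => 4 * (1 - h N)) 4.
- by move=> n; have := h0 n; lra.
- move=> n; rewrite /u big_ord_recr /= addrC addrK nrmZr (ger0_norm (ltW (h0 _))).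
  have [[_ _ _ _ mn] _] := mzP n.
  rewrite hS; move: (nrm_ge0 (m n)) mn; rewrite -/(m n).
  have := h0 n. nra.
exists a; first exact: ncvg_sa ua.
have az k : a ** z k = (h k)%:C *: z k.
  (* From [N = k + 1] on, [u N ** z k] is constant, as only the term [k] acts on [z k]. *)
  apply: (ncvg_unique (ncvgMr (z k) ua)) => d d0; exists k.+1 => N kN.
  rewrite cmul_suml (bigD1 (Ordinal kN)) //= big1 ?addr0 => [|i]; last first.
    rewrite -val_eqE /= => /eqP ik.
    by rewrite cmulZl mzD ?scaler0.
  have [[_ _ _ mzk _] _] := mzP k.
  by rewrite cmulZl mzk subrr nrm0.
have spk k : spec a (h k)%:C.
  by apply: spec_eigenvector (az k); have [[]] := mzP k.
move=> fin; apply: infinite_nat.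
have -> : [set: nat] = (fun k => (h k)%:C : R[i]) @^-1` spec a.
  by apply/seteqP; split => k // _; exact: spk.
by apply: finite_preimage fin => i j _ _ /complexI /h_inj.
Qed.

End InfiniteSpectrum.

(** * Nonexpansive maps in finite dimension *)

Lemma normr_row_coord (R : realType) n (v : 'rV[R]_n) j : `|v 0 j| <= `|v|.
Proof.
rewrite [leRHS]/Num.Def.normr /= mx_normrE.
by apply/bigmax_geP; right => /=; exists (0, j).
Qed.

Section RealCoordinates.
Context {R : realType} {B : normedModType R[i]} {n : nat}.
Variable b : 'I_n -> B.
Hypothesis b_coord : forall x, exists c : 'I_n -> R, x = \sum_i (c i)%:C *: b i.
Hypothesis b_free : forall c : 'I_n -> R, \sum_i (c i)%:C *: b i = 0 -> forall i, c i = 0.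

(** Real coordinates, so that compactness and extreme values in ['rV[R]_n] apply. *)
Definition rcomb (v : 'rV[R]_n) : B := \sum_i (v 0 i)%:C *: b i.

Lemma rcombB v w : rcomb v - rcomb w = rcomb (v - w).
Proof.
rewrite /rcomb -sumrB; apply: eq_bigr => i _.
by rewrite !mxE rmorphB scalerBl.
Qed.

Lemma rcombZ r v : rcomb (r *: v) = r%:C *: rcomb v.
Proof.
rewrite /rcomb scaler_sumr; apply: eq_bigr => i _.
by rewrite !mxE rmorphM scalerA.
Qed.

Lemma nrm_sum (I : Type) (s : seq I) (F : I -> B) :
  nrm (\sum_(i <- s) F i) <= \sum_(i <- s) nrm (F i).
Proof.
elim: s => [|i s IH]; first by rewrite !big_nil nrm0.
by rewrite !big_cons; apply: le_trans (nrmD _ _) _; rewrite lerD2l.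
Qed.

Lemma rcomb_lip v : nrm (rcomb v) <= (\sum_i nrm (b i)) * `|v|.
Proof.
apply: le_trans (nrm_sum _ _) _; rewrite mulr_suml; apply: ler_sum => i _.
by rewrite nrmZr mulrC ler_wpM2l ?nrm_ge0// normr_row_coord.
Qed.

(** Equivalence of norms: [m] is the minimum over the compact unit sphere, positive because [b] is
    free. *)
Lemma rcomb_coercive : exists2 m : R, 0 < m & forall v, m * `|v| <= nrm (rcomb v).
Proof.
pose S := [set v : 'rV[R]_n | `|v| = 1].
(* The sphere is empty when [n = 0]; then [0] is the only vector and any [m] will do. *)
have [S0|/set0P/negP/negPn/eqP S0] := pselect (S !=set0); last first.
  exists 1 => // v; have [->|v0] := eqVneq v 0; first by rewrite normr0 mulr0 nrm_ge0.
  have : S (`|v|^-1 *: v).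
    by rewrite /S /= normrZ ger0_norm ?invr_ge0// mulVf// normr_eq0.
  by rewrite S0.
have cS : compact S.
  apply: bounded_closed_compact.
    exists 1; split; first exact: num_real.
    by move=> r r1 v; rewrite /S /= => ->; exact: ltW.
  rewrite (_ : S = (fun v : 'rV[R]_n => `|v|) @^-1` [set 1]); last by [].
  apply: preimage_closed => [v _|]; first exact: norm_continuous.
  exact: closed_eq.
have [|v0 /[!inE] Sv0 vmin] := @EVT_min_rV R n (fun v => nrm (rcomb v)) S S0 cS.
  apply: (@lipschitz_within _ _ _ _ (\sum_i nrm (b i))) => v w _ _.
  by apply: le_trans (nrm_lip _ _) _; rewrite rcombB rcomb_lip.
exists (nrm (rcomb v0)).
  rewrite nrm_gt0; apply/eqP => /b_free h.
  have v00 : v0 = 0 by apply/rowP => i; rewrite h mxE.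
  by move: Sv0; rewrite /S /= v00 normr0 => /eqP; rewrite eq_sym oner_eq0.
move=> v; have [->|v_neq0] := eqVneq v 0; first by rewrite normr0 mulr0 nrm_ge0.
have nv : 0 < `|v| by rewrite normr_gt0.
have : S (`|v|^-1 *: v).
  by rewrite /S /= normrZ ger0_norm ?invr_ge0// mulVf// gt_eqF.
move=> /mem_set/vmin; rewrite rcombZ nrmZr ger0_norm ?invr_ge0//.
by rewrite ler_pdivlMl// mulrC.
Qed.

(** In coordinates [C] is bounded by coercivity and closed because [rcomb] is Lipschitz, hence
    compact; the displacement is Lipschitz too. *)
Lemma attained_displacement (C : set B) (f : B -> B) :
  C !=set0 -> bounded_set C -> closed C -> (forall x, C x -> C (f x)) ->
  (forall x y, C x -> C y -> nrm (f x - f y) <= nrm (x - y)) ->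
  exists2 x, C x & forall y, C y -> nrm (f x - x) <= nrm (f y - y).
Proof.
move=> [x0 Cx0] [M [_ CM]] clC fC f_ne.
have [m m0 hm] := rcomb_coercive.
have sur x : exists v, rcomb v = x.
  have [c ->] := b_coord x; exists (\row_i c i).
  by apply: eq_bigr => i _; rewrite mxE.
pose D := [set v | C (rcomb v)].
have D0 : D !=set0 by have [v vx] := sur x0; exists v; rewrite /D /= vx.
have cD : compact D.
  apply: bounded_closed_compact.
    (* [bounded_set] only provides bounds strictly above [M]. *)
    have CM1 := CM (M + 1); pose M1 := complex.Re (M + 1).
    exists (M1 / m); split; first exact: num_real.
    move=> r rM v Dv; apply: le_trans (ltW rM).
    rewrite ler_pdivlMr// mulrC; apply: le_trans (hm v) _.
    have : `|rcomb v| <= M + 1 by apply: CM1 => //; rewrite ltrDl.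
    by rewrite lecE => /andP [_].
  have /closed_approximable clC' := clC.
  rewrite closure_id; apply/seteqP; split; first exact: subset_closure.
  move=> v clv; apply: clC' => e e0.
  pose L := \sum_i nrm (b i) + 1.
  have L0 : 0 < L by rewrite ltr_wpDl// sumr_ge0// => i _; exact: nrm_ge0.
  have [w [Dw]] : D `&` ball v (e / L) !=set0.
    by apply: clv; apply: nbhsx_ballx; rewrite divr_gt0.
  rewrite -ball_normE /= distrC ltr_pdivlMr// => wv.
  exists (rcomb w) => //; rewrite rcombB.
  apply: le_lt_trans (rcomb_lip _) _; apply: le_lt_trans wv.
  by rewrite mulrC ler_wpM2l// lerDl.
have [|v /[!inE] Dv vmin] :=
    @EVT_min_rV R n (fun v => nrm (f (rcomb v) - rcomb v)) D D0 cD.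
  apply: (@lipschitz_within _ _ _ _ (2 * \sum_i nrm (b i))) => v w Dv Dw.
  apply: le_trans (nrm_lip _ _) _.
  have -> : f (rcomb v) - rcomb v - (f (rcomb w) - rcomb w) =
    (f (rcomb v) - f (rcomb w)) - (rcomb v - rcomb w) by module.
  apply: le_trans (nrmB _ _) _; have := f_ne _ _ Dv Dw; have := rcomb_lip (v - w).
  by rewrite -rcombB; lra.
exists (rcomb v) => // y Cy; have [w wy] := sur y; rewrite -wy.
by apply: vmin; rewrite inE /D /= wy.
Qed.

End RealCoordinates.

Section FixedPoints.
Context {R : realType} {B : completeNormedModType R[i]}.

(** For [0 < t <= 1], the map [t x0 + (1 - t) M] contracts by [1 - t], so its point of least
    displacement is fixed; there [M] moves by at most [t D]. Hence the least displacement of [M] is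
    zero. *)
Lemma finite_dimensional_fixed_point_property :
  finite_dimensional B -> fixed_point_property B.
Proof.
move=> [n [[h h_lin h_bij]]] C C0 Cbnd Ccl Ccvx M M_ne.
pose H : {linear B -> 'rV[R[i]]_n} := HB.pack h (GRing.isLinear.Build _ _ _ _ h h_lin).
have [g hg gh] := h_bij.
have hZ k x : h (k *: x) = k *: h x by exact: (linearZ_LR H).
(* A real basis: the complex basis vectors, followed by their multiples by [i]. *)
pose b (ij : 'I_(n + n)) : B :=
  match fintype.split ij with
  | inl j => g (delta_mx 0 j)
  | inr j => g ('i%C *: delta_mx 0 j)
  end.
have hb (c : 'I_(n + n) -> R) :
    h (\sum_i (c i)%:C *: b i) = \row_j ((c (lshift n j)) +i* (c (rshift n j))).
  rewrite -[h]/(H : _ -> _) linear_sum big_split_ord /=.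
  rewrite [RHS]row_sum_delta -big_split; apply: eq_bigr => j _.
  rewrite !hZ /b (unsplitK (inl _)) (unsplitK (inr _)) !gh.
  rewrite scalerA mxE; apply: etrans (esym (scalerDl _ _ _)) _; congr (_ *: _).
  by apply/eqP; rewrite eq_complex /= !(mul0r, mulr0, mulr1, subr0, addr0, add0r) !eqxx.
have b_coord x : exists c : 'I_(n + n) -> R, x = \sum_i (c i)%:C *: b i.
  exists (fun ij => match fintype.split ij with
    inl j => complex.Re (h x 0 j) | inr j => complex.Im (h x 0 j) end).
  apply: (bij_inj h_bij); rewrite hb; apply/rowP => j; rewrite !mxE.
  by rewrite (unsplitK (inl _)) (unsplitK (inr _)); case: (h x 0 j).
have b_free (c : 'I_(n + n) -> R) : \sum_i (c i)%:C *: b i = 0 -> forall i, c i = 0.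
  move=> /(congr1 h); rewrite hb -[h]/(H : _ -> _) linear0 => /rowP e i.
  by rewrite -(splitK i); case: (fintype.split i) => j; have := e j; rewrite !mxE => -[].
have attained := attained_displacement b_coord b_free C0 Cbnd Ccl.
have CM x : C x -> C (M x) by exact: funS.
have M_ne' x y : C x -> C y -> nrm (M x - M y) <= nrm (x - y).
  by move=> Cx Cy; rewrite -nrm_le M_ne.
have [x0 Cx0] := C0.
have [D hD] : exists D : R, forall x, C x -> nrm (x - x0) <= D.
  have [m [_ Cm]] := Cbnd; exists (complex.Re (m + 1) + complex.Re (m + 1)) => x Cx.
  have bnd y : C y -> nrm y <= complex.Re (m + 1).
    move=> Cy; have : `|y| <= m + 1 by apply: Cm => //; rewrite ltrDl.
    by rewrite lecE => /andP[].
  by apply: le_trans (nrmB _ _) _; apply: lerD; exact: bnd.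
have convC (t : R) x y : 0 <= t -> t <= 1 -> C x -> C y -> C (t%:C *: x + (1 - t)%:C *: y).
  move=> t0 t1 Cx Cy.
  have t0' : 0 <= t%:C by rewrite ler0c.
  have t1' : t%:C <= 1 by rewrite -(rmorph1 (real_complex R)) lecR.
  have := Ccvx x y (Itv01 t0' t1'); rewrite !inE => /(_ Cx Cy).
  by rewrite /conv /= rmorphB rmorph1.
have approx (t : R) : 0 < t -> t <= 1 -> exists2 x, C x & nrm (M x - x) <= t * D.
  move=> t0 t1; pose f x := t%:C *: x0 + (1 - t)%:C *: M x.
  have f_lip x y : C x -> C y -> nrm (f x - f y) <= (1 - t) * nrm (x - y).
    move=> Cx Cy; have -> : f x - f y = (1 - t)%:C *: (M x - M y) by rewrite /f; module.
    by rewrite nrmZr ger0_norm ?subr_ge0// ler_wpM2l ?subr_ge0// M_ne'.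
  have fC x : C x -> C (f x) by move=> Cx; apply: convC => //; [exact: ltW | exact: CM].
  have [|x Cx xmin] := attained f fC.
    move=> x y Cx Cy; apply: le_trans (f_lip _ _ Cx Cy) _.
    by have := nrm_ge0 (x - y); nra.
  have fx : f x = x.
    apply/eqP; rewrite -subr_eq0; apply/eqP/nrm_le0.
    have := xmin _ (fC _ Cx); have := f_lip _ _ (fC _ Cx) Cx.
    by have := nrm_ge0 (f x - x); nra.
  exists x => //; have -> : M x - x = t%:C *: (M x - x0).
    by rewrite -{2}fx /f rmorphB rmorph1 /=; module.
  by rewrite nrmZr gtr0_norm// ler_pM2l//; apply/hD/CM.
have [x Cx xmin] := attained M CM M_ne'.
exists x => //; apply/eqP; rewrite -subr_eq0; apply/eqP/nrm_eps => e e0.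
have D0 : 0 <= D by have := hD _ Cx0; rewrite subrr nrm0.
(* Ensures [t <= 1] and [t D <= e]; [D + 1] avoids a division by zero. *)
pose t := Num.min 1 (e / (D + 1)).
have D1 : 0 < D + 1 by rewrite ltr_wpDl.
have t0 : 0 < t by rewrite lt_min ltr01 divr_gt0.
have [|y Cy yt] := approx t t0; first by rewrite ge_min lexx.
apply: le_trans (xmin _ Cy) _; apply: le_trans yt _.
have : t <= e / (D + 1) by rewrite ge_min lexx orbT.
rewrite ler_pdivlMr//; nra.
Qed.

End FixedPoints.

Theorem theorem1p1 (R : realType) (A : cstarAlgType R)
    (A_neq0 : exists a : A, a != 0) :
  [<-> fixed_point_property A;
       forall a : A, cstar a = a -> finite_set (spec a);
       finite_dimensional A].
Proof.
tfae.
(* This implication already passes through finite dimension. *)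
- move=> /fixed_point_property_no_orthogonal_sequence.
  move=> /no_orthogonal_sequence_finite_dimensional fdA a _.
  exact: finite_spec_of_finite_dimensional.
- move=> fin; apply: no_orthogonal_sequence_finite_dimensional => -[e].
  by move=> /orthogonal_sequence_infinite_spec [a sa_a]; apply; exact: fin.
- exact: finite_dimensional_fixed_point_property.
Qed.
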